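(* Fix $L\in\mathbb{N}$ and $\rho,\lambda_\sigma,\alpha>0$. There exists $c>0$ depending only on $L,\rho,\lambda_\sigma,\alpha$ such that whenever: (1) $X,W_0,\dots,W_{L-1}$ are stochastically independent; (2) each of $X$ (in $\mathbb{R}^{n_0n}$) and $W_\ell$ (in $\mathbb{R}^{n_{\ell+1}n_\ell}$) satisfies the subgaussian concentration property with constant $\rho$; (3) $X$ is centered; (4) $B_\ell=0$ for all $\ell$; (5) the law of each $W_\ell$ is symmetric with respect to the origin ($W_\ell$ and $-W_\ell$ have the same law); (6) each $\sigma_\ell$ is $\lambda_\sigma$-Lipschitz and odd; (7) $n/n_\ell\le\alpha$ for $\ell=1,\dots,L$; then for every $F\colon\mathbb{R}^{n_L\times n}\to\mathbb{R}$, $1$-Lipschitz with respect to the Hilbert--Schmidt norm, and every $t>0$, $$\mathbb{P}(|F(Z_L)-\mathbb{E}F(Z_L)|\ge t)\le2\exp\Big(-c\min(n,n_0)\min(t^2,t^{2/(L+1)})\Big).$$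
   Context: Model: $L,n_0,\dots,n_L,n$ positive integers; $X$ an $n_0\times n$ random matrix, $W_\ell$ an $n_{\ell+1}\times n_\ell$ random matrix, $B_\ell$ a random vector in $\mathbb{R}^{n_{\ell+1}}$, $\sigma_\ell\colon\mathbb{R}\to\mathbb{R}$, $\ell=0,\dots,L-1$; functions act on matrices entrywise. $Z_0=n_0^{-1/2}X$, $Z_{\ell+1}=n_{\ell+1}^{-1/2}\sigma_\ell(W_\ell Z_\ell+B_\ell\mathbf{1}_n^T)$ (here $B_\ell=0$). A random vector $Y$ in $\mathbb{R}^M$ satisfies the subgaussian concentration property with constant $\rho$ if for every Euclidean $1$-Lipschitz $G\colon\mathbb{R}^M\to\mathbb{R}$ and $t>0$, $\mathbb{P}(|G(Y)-\mathrm{Med}\,G(Y)|\ge t)\le2e^{-t^2/\rho^2}$ (any median). $\|\cdot\|_{HS}$ is the Hilbert--Schmidt norm. *)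

(* Defs.v *)
From HB Require Import structures.
From mathcomp Require Import all_boot all_order all_algebra.
From mathcomp Require Import all_classical all_reals all_analysis.
Set Implicit Arguments. Unset Strict Implicit. Unset Printing Implicit Defensive.
Import Order.TTheory GRing.Theory Num.Theory.
Import numFieldNormedType.Exports.
Local Open Scope classical_set_scope.
Local Open Scope ring_scope.

Section Defs.
Variable R : realType.

Definition hs_norm (p q : nat) (A : 'M[R]_(p, q)) : R :=
  Num.sqrt (\sum_(i < p) \sum_(j < q) A i j ^+ 2).

Definition hs_lipschitz (p q : nat) (k : R) (G : 'M[R]_(p, q) -> R) : Prop :=
  forall A B, `|G A - G B| <= k * hs_norm (A - B).

Definition mx_borel (p q : nat) : set (set 'M[R]_(p, q)) :=
  <<s [set S | exists (i : 'I_p) (j : 'I_q) (B : set R),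
                 measurable B /\ S = (fun A : 'M[R]_(p, q) => A i j) @^-1` B] >>.

Context {d : measure_display} {T : measurableType d} (P : probability T R).

Definition random_mx (p q : nat) (Y : T -> 'M[R]_(p, q)) : Prop :=
  forall i j, measurable_fun setT (fun w => Y w i j).

Definition is_median (f : T -> R) (m : R) : Prop :=
  ((2^-1)%:E <= P [set w | (f w <= m)%R])%E /\ ((2^-1)%:E <= P [set w | (m <= f w)%R])%E.

Definition subgaussian_conc (p q : nat) (rho : R) (Y : T -> 'M[R]_(p, q)) : Prop :=
  forall G : 'M[R]_(p, q) -> R, hs_lipschitz 1 G ->
  forall m, is_median (fun w => G (Y w)) m ->
  forall t, 0 < t ->
  (P [set w | (t <= `|G (Y w) - m|)%R] <= (2 * expR (- (t ^+ 2) / rho ^+ 2))%:E)%E.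

Definition symmetric_law (p q : nat) (Y : T -> 'M[R]_(p, q)) : Prop :=
  forall S, mx_borel S -> P (Y @^-1` S) = P ((fun w => - Y w) @^-1` S).

End Defs.

(* The network: N l = n_l (widths), n = sample count. Z_0 = n_0^{-1/2} X,
   Z_{l+1} = n_{l+1}^{-1/2} sigma_l (W_l Z_l)   (biases B_l = 0). *)
Fixpoint netZ (R : realType) (n : nat) (N : nat -> nat)
  (X : 'M[R]_(N 0%N, n)) (W : forall l : nat, 'M[R]_(N l.+1, N l))
  (sigma : nat -> R -> R) (l : nat) : 'M[R]_(N l, n) :=
  match l return 'M[R]_(N l, n) with
  | 0%N => (Num.sqrt (N 0%N)%:R)^-1 *: X
  | l'.+1 => (Num.sqrt (N l'.+1)%:R)^-1 *:
             map_mx (sigma l') (W l' *m netZ X W sigma l')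
  end.

(* Main.v *)
Require Import Defs.
From HB Require Import structures.
From mathcomp Require Import all_boot all_order all_algebra.
From mathcomp Require Import all_classical all_reals all_analysis.
From mathcomp Require Import measurable_realfun ring lra.
Set Implicit Arguments. Unset Strict Implicit. Unset Printing Implicit Defensive.
Import Order.TTheory GRing.Theory Num.Theory.
Import numFieldNormedType.Exports.
Local Open Scope classical_set_scope.
Local Open Scope ring_scope.

(* Induction on the number of layers. Let m = min(n, n_0). Conditionally on
   Z_l = z, the map W |-> F(n_{l+1}^{-1/2} sigma(W z)) is Lipschitz with constant
   lam |z|_op n_{l+1}^{-1/2}, so F(Z_{l+1}) concentrates around its conditional
   mean F'(Z_l). Although W itself may have a large operator norm, F' is Lipschitz
   with a constant depending only on rho and lam, because linear functions of W
   have variance O(rho^2); so the induction hypothesis applies to F'.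
   The operator norm of Z_l is estimated on finite nets: since sigma is odd and the
   law of W symmetric, u sigma(W z) v has median 0, and the union bound gives
   |Z_l|_op = O(r^(l+1) sqrt(1 + n/n_0)) outside an event of probability
   O(exp(- m r^2)), for every r >= 1. The resulting bound
   C exp(- c m min(r^2, t^2 / r^(2L))) is optimised by r = max(1, t^(1/(L+1))).
   Concentration is first obtained around some constant with a prefactor C; an
   integration of the tail moves it to the mean with prefactor 2. *)

(** * Hilbert-Schmidt norm and operator norm *)

(** The factor [m] has two sources. The net bound fails with exponent [(n_0 + n) r^2] at the input
    and [(n_{l+1} + n) r^2] at each layer, both at least [m r^2]. The conditional fluctuation gains
    [n_{l+1}] from the normalisation and loses [1 + n/n_0] from the squared norm of [Z_l]; since
    [n <= alpha n_{l+1}], the quotient is at least [m / (2 alpha)]. The norm grows only by a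
    constant times [r] per layer because [(n_{l+1} + n) / n_{l+1} <= 1 + alpha]. Symmetry and
    oddness put a median at 0 without any expectation being computed through the nonlinearity. [X]
    is only centered, which is enough because [Z_0] is linear in [X]. No conditional expectation is
    formed. The past [(X, W_0, ..., W_{l-1})] and [W_l] generate independent sigma-algebras; the
    sample space is doubled, each copy carrying one of them, and conditioning means fixing the first
    coordinate. *)

Lemma cauchy_schwarz_sum (R : realFieldType) (I : finType) (a b : I -> R) :
  (\sum_i a i * b i) ^+ 2 <= (\sum_i a i ^+ 2) * (\sum_i b i ^+ 2).
Proof.
set A := \sum_i a i ^+ 2; set B := \sum_i b i ^+ 2; set C := \sum_i a i * b i.
have A0 : 0 <= A by apply: sumr_ge0 => i _; exact: sqr_ge0.
have quad x : 0 <= A * x ^+ 2 - C * x * 2 + B.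
  have -> : A * x ^+ 2 - C * x * 2 + B = \sum_i (a i * x - b i) ^+ 2.
    rewrite -mulrA !mulr_suml -sumrB -big_split /=.
    by apply: eq_bigr => i _; ring.
  by apply: sumr_ge0 => i _; exact: sqr_ge0.
have [A_eq0|A_neq0] := eqVneq A 0.
  have a0 i : a i = 0.
    apply/eqP; rewrite -sqrf_eq0; apply/eqP.
    by apply: (psumr_eq0P _ A_eq0) => // j _; exact: sqr_ge0.
  rewrite /C big1 => [|i _]; last by rewrite a0 mul0r.
  by rewrite expr0n A_eq0 mul0r.
(* The quadratic is evaluated at its minimiser [C / A]; the factor [A] clears the denominator. *)
have Apos : 0 < A by rewrite lt_neqAle eq_sym A_neq0.
have := mulr_ge0 A0 (quad (C / A)).
have -> : A * (A * (C / A) ^+ 2 - C * (C / A) * 2 + B) = A * B - C ^+ 2 by field.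
by rewrite subr_ge0.
Qed.

Section HilbertSchmidt.
Variable R : realType.
Implicit Types p q r : nat.

Lemma hs_norm_ge0 p q (A : 'M[R]_(p, q)) : 0 <= hs_norm A.
Proof. exact: sqrtr_ge0. Qed.

Lemma hs_norm_sqr p q (A : 'M[R]_(p, q)) :
  hs_norm A ^+ 2 = \sum_i \sum_j A i j ^+ 2.
Proof.
by rewrite sqr_sqrtr// sumr_ge0// => i _; rewrite sumr_ge0// => j _; exact: sqr_ge0.
Qed.

Lemma hs_norm_le p q (A : 'M[R]_(p, q)) (c : R) : 0 <= c ->
  \sum_i \sum_j A i j ^+ 2 <= c ^+ 2 -> hs_norm A <= c.
Proof. by move=> c0; rewrite -hs_norm_sqr ler_sqr ?nnegrE ?hs_norm_ge0. Qed.

Lemma hs_norm_entry p q (A : 'M[R]_(p, q)) i j : `|A i j| <= hs_norm A.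
Proof.
rewrite -ler_sqr ?nnegrE ?hs_norm_ge0// hs_norm_sqr real_normK ?num_real//.
rewrite (bigD1 i)//= (bigD1 j)//= -addrA lerDl addr_ge0 ?sumr_ge0// => k _.
  exact: sqr_ge0.
by rewrite sumr_ge0// => l _; exact: sqr_ge0.
Qed.

Lemma hs_norm0 p q : hs_norm (0 : 'M[R]_(p, q)) = 0.
Proof.
apply/le_anti; rewrite hs_norm_ge0 andbT hs_norm_le// expr0n/=.
by rewrite big1// => i _; rewrite big1// => j _; rewrite mxE expr0n.
Qed.

Lemma hs_norm_eq0 p q (A : 'M[R]_(p, q)) : hs_norm A = 0 -> A = 0.
Proof.
move=> A0; apply/matrixP => i j; rewrite mxE; apply/eqP.
by rewrite -normr_le0 -A0 hs_norm_entry.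
Qed.

Lemma hs_normZ p q (k : R) (A : 'M[R]_(p, q)) : hs_norm (k *: A) = `|k| * hs_norm A.
Proof.
apply/eqP; rewrite -(eqrXn2 (n := 2))// ?mulr_ge0 ?hs_norm_ge0//.
rewrite exprMn !hs_norm_sqr real_normK ?num_real// mulr_sumr; apply/eqP.
apply: eq_bigr => i _; rewrite mulr_sumr; apply: eq_bigr => j _.
by rewrite mxE exprMn.
Qed.

Lemma hs_norm_tr p q (A : 'M[R]_(p, q)) : hs_norm A^T = hs_norm A.
Proof.
rewrite /hs_norm exchange_big/=; congr Num.sqrt.
by apply: eq_bigr => i _; apply: eq_bigr => j _; rewrite mxE.
Qed.

Lemma hs_norm11 (A : 'M[R]_1) : hs_norm A = `|A 0 0|.
Proof. by rewrite /hs_norm !big_ord1 sqrtr_sqr. Qed.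

Lemma hs_norm_row_sum p q (A : 'M[R]_(p, q)) :
  hs_norm A ^+ 2 = \sum_i hs_norm (row i A) ^+ 2.
Proof.
rewrite hs_norm_sqr; apply: eq_bigr => i _; rewrite hs_norm_sqr big_ord1.
by apply: eq_bigr => j _; rewrite mxE.
Qed.

Lemma hs_norm_col_sum p q (A : 'M[R]_(p, q)) :
  hs_norm A ^+ 2 = \sum_j hs_norm (col j A) ^+ 2.
Proof.
rewrite -hs_norm_tr hs_norm_row_sum; apply: eq_bigr => j _.
by rewrite -tr_col hs_norm_tr.
Qed.

Lemma hs_norm_mulmx p q r (A : 'M[R]_(p, q)) (B : 'M[R]_(q, r)) :
  hs_norm (A *m B) <= hs_norm A * hs_norm B.
Proof.
apply: hs_norm_le; first by rewrite mulr_ge0 ?hs_norm_ge0.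
rewrite exprMn hs_norm_sqr mulr_suml; apply: ler_sum => i _.
rewrite hs_norm_col_sum mulr_sumr; apply: ler_sum => j _; rewrite mxE.
apply: le_trans (cauchy_schwarz_sum _ _) _; rewrite hs_norm_sqr.
under [X in _ <= _ * X]eq_bigr do rewrite big_ord1 mxE.
exact: lexx.
Qed.

(** An upper bound on the operator norm of right multiplication by [A], kept as a predicate so that
    no supremum has to be handled. *)
Definition op_bound p q (A : 'M[R]_(p, q)) (K : R) :=
  forall u : 'rV[R]_p, hs_norm (u *m A) <= K * hs_norm u.

Lemma op_bound_hs_norm p q (A : 'M[R]_(p, q)) : op_bound A (hs_norm A).
Proof. by move=> u; rewrite mulrC hs_norm_mulmx. Qed.

(** Squared norms add up over the rows of [A], and [B] acts on each row separately. Hence the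
    Lipschitz constant of a layer in its weights involves only the operator norm of its input. *)
Lemma hs_norm_mulmx_op p q r (K : R) (A : 'M[R]_(p, q)) (B : 'M[R]_(q, r)) :
  0 <= K -> op_bound B K -> hs_norm (A *m B) <= K * hs_norm A.
Proof.
move=> K0 BK; rewrite -ler_sqr ?nnegrE ?mulr_ge0 ?hs_norm_ge0//.
rewrite exprMn !hs_norm_row_sum mulr_sumr; apply: ler_sum => i _.
by rewrite row_mul -exprMn ler_sqr ?nnegrE ?mulr_ge0 ?hs_norm_ge0.
Qed.

Lemma hs_norm_map_mx p q (lam : R) (s : R -> R) (A B : 'M[R]_(p, q)) :
  0 <= lam -> (forall x y, `|s x - s y| <= lam * `|x - y|) ->
  hs_norm (map_mx s A - map_mx s B) <= lam * hs_norm (A - B).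
Proof.
move=> lam0 sL; apply: hs_norm_le; first by rewrite mulr_ge0 ?hs_norm_ge0.
rewrite exprMn hs_norm_sqr mulr_sumr; apply: ler_sum => i _.
rewrite mulr_sumr; apply: ler_sum => j _; rewrite !mxE.
rewrite -[leLHS]real_normK ?num_real// -[(A i j - B i j) ^+ 2]real_normK ?num_real//.
by rewrite -exprMn ler_sqr ?nnegrE ?mulr_ge0// sL.
Qed.

Definition bilin p q (u : 'rV[R]_p) (A : 'M[R]_(p, q)) (v : 'rV[R]_q) : R :=
  (u *m A *m v^T) 0 0.

Lemma bilinE p q (u : 'rV[R]_p) (A : 'M[R]_(p, q)) (v : 'rV[R]_q) :
  bilin u A v = \sum_j \sum_i u 0 i * A i j * v 0 j.
Proof.
rewrite /bilin mxE; apply: eq_bigr => j _; rewrite mxE mulr_suml.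
by apply: eq_bigr => i _; rewrite mxE.
Qed.

Lemma bilin_le p q (u : 'rV[R]_p) (A : 'M[R]_(p, q)) (v : 'rV[R]_q) :
  `|bilin u A v| <= hs_norm u * hs_norm A * hs_norm v.
Proof.
rewrite -hs_norm11 (le_trans (hs_norm_mulmx _ _))// hs_norm_tr.
by rewrite ler_wpM2r ?hs_norm_ge0// hs_norm_mulmx.
Qed.

Lemma bilinB p q (u : 'rV[R]_p) (A B : 'M[R]_(p, q)) (v : 'rV[R]_q) :
  bilin u A v - bilin u B v = bilin u (A - B) v.
Proof. by rewrite /bilin mulmxBr mulmxBl !mxE. Qed.

Lemma bilinZ p q (a b : R) (u : 'rV[R]_p) (A : 'M[R]_(p, q)) (v : 'rV[R]_q) :
  bilin (a *: u) A (b *: v) = a * b * bilin u A v.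
Proof. by rewrite /bilin linearZ/= -!scalemxAl -scalemxAr scalerA mxE. Qed.

Lemma bilinZm p q (a : R) (u : 'rV[R]_p) (A : 'M[R]_(p, q)) (v : 'rV[R]_q) :
  bilin u (a *: A) v = a * bilin u A v.
Proof. by rewrite /bilin -scalemxAr -scalemxAl mxE. Qed.

Definition unit_net p (S : seq 'rV[R]_p) :=
  [/\ (forall u, u \in S -> hs_norm u <= 1) &
     forall u, hs_norm u <= 1 -> exists2 v, v \in S & hs_norm (u - v) <= 4^-1].

(* If M is the supremum of |u A v| over unit vectors, approximating u and v in
   the nets loses at most M/4 each, hence M <= s + M/2. *)
Lemma op_bound_net p q (A : 'M[R]_(p, q)) (s : R) Sp Sq :
  unit_net Sp -> unit_net Sq ->
  (forall u v, u \in Sp -> v \in Sq -> `|bilin u A v| <= s) ->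
  op_bound A (2 * s).
Proof.
move=> [Sp1 Spn] [Sq1 Sqn] As.
pose E := [set x : R | exists u v, [/\ hs_norm u <= 1, hs_norm v <= 1 &
                                     x = `|bilin u A v| ]].
have ubE : ubound E (hs_norm A).
  move=> _ [u [v [u1 v1 ->]]]; rewrite (le_trans (bilin_le _ _ _))//.
  rewrite -[leRHS]mulr1 ler_pM ?mulr_ge0 ?hs_norm_ge0//.
  by rewrite -[leRHS]mul1r ler_wpM2r ?hs_norm_ge0.
have E0 : E !=set0.
  exists `|bilin (0 : 'rV_p) A (0 : 'rV_q)|; exists 0, 0.
  by rewrite !hs_norm0; split => //; exact: ler01.
have supE : has_sup E by split => //; exists (hs_norm A).
pose M := sup E.
have leM u v : hs_norm u <= 1 -> hs_norm v <= 1 -> `|bilin u A v| <= M.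
  by move=> u1 v1; apply: ub_le_sup; [exists (hs_norm A)|exists u, v].
have le4 u v : hs_norm u <= 1 -> hs_norm v <= 4^-1 -> `|bilin u A v| <= M / 4.
  move=> u1 v1; have := leM (1 *: u) (4 *: v).
  rewrite bilinZ mul1r !hs_normZ !normrM !normr1 mul1r => /(_ u1).
  by rewrite ger0_norm//; lra.
have le4' u v : hs_norm u <= 4^-1 -> hs_norm v <= 1 -> `|bilin u A v| <= M / 4.
  move=> u1 v1; have := leM (4 *: u) (1 *: v).
  rewrite bilinZ mulr1 !hs_normZ !normrM normr1 !mul1r ger0_norm//.
  by move=> /(_ _ v1); lra.
have M2s : M <= 2 * s.
  suff : M <= s + M / 2 by lra.
  apply: ge_sup => // _ [u [v [u1 v1 ->]]].
  have [u0 u0S uu0] := Spn _ u1; have [v0 v0S vv0] := Sqn _ v1.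
  have -> : bilin u A v = bilin u0 A v0 + bilin (u - u0) A v + bilin u0 A (v - v0).
    by rewrite /bilin linearB/= !mulmxBl mulmxBr !mxE; ring.
  rewrite (le_trans (ler_normD _ _))// (le_trans (lerD (ler_normD _ _) (lexx _)))//.
  have := As _ _ u0S v0S; have := le4' _ _ uu0 v1; have := le4 _ _ (Sp1 _ u0S) vv0.
  by lra.
move=> u; have [->|u0] := eqVneq u 0.
  by rewrite mul0mx !hs_norm0 mulr0.
have hu : 0 < hs_norm u.
  rewrite lt_neqAle hs_norm_ge0 andbT eq_sym.
  by apply: contra u0 => /eqP/hs_norm_eq0/eqP.
(* Duality: testing the form against the normalised vector [w] itself recovers the norm of
   [u *m A]. *)
set w := u *m A.
have [w0|w0] := eqVneq (hs_norm w) 0.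
  have M0 : 0 <= M by apply: le_trans (leM 0 0 _ _); rewrite ?hs_norm0 ?ler01.
  rewrite w0 mulr_ge0 ?(ltW hu)//. exact: le_trans M0 M2s.
have hw : 0 < hs_norm w by rewrite lt_neqAle eq_sym w0 hs_norm_ge0.
have bw : bilin u A w = hs_norm w ^+ 2.
  rewrite /bilin -/w hs_norm_sqr big_ord1 mxE; apply: eq_bigr => j _.
  by rewrite [w^T _ _]mxE expr2.
have := leM ((hs_norm u)^-1 *: u) ((hs_norm w)^-1 *: w).
rewrite !hs_normZ !normfV !(ger0_norm (hs_norm_ge0 _)).
rewrite !mulVf ?gt_eqF// bilinZ bw => /(_ (lexx _) (lexx _)).
have -> : (hs_norm u)^-1 * (hs_norm w)^-1 * hs_norm w ^+ 2 = hs_norm w / hs_norm u.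
  by field; rewrite !gt_eqF.
rewrite ger0_norm ?divr_ge0 ?hs_norm_ge0// => h.
have := le_trans h M2s.
by rewrite ler_pdivrMr.
Qed.

End HilbertSchmidt.

(** * Finite nets of the unit ball *)

Lemma sum_pow2_rev (M : nat) : (\sum_(j < M.+1) 2 ^ (M - j) <= 2 ^ M.+1)%N.
Proof.
suff : (\sum_(j < M.+1) 2 ^ (M - j) < 2 ^ M.+1)%N by move/ltnW.
elim: M => [|M IH]; first by rewrite big_ord1.
rewrite big_ord_recl subn0 (eq_bigr (fun j : 'I_M.+1 => 2 ^ (M - j))%N) => [|j _].
  by rewrite [X in (_ < X)%N]expnS mul2n -addnn ltn_add2l.
by rewrite lift0 subSS.
Qed.

(* Weighting [f] by 2 ^ (M - (f i).2) in each coordinate bounds the number of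
   integer points of a ball by a product. *)
Lemma card_lattice_ball (p k M : nat) :
  (#|[pred f : {ffun 'I_p -> bool * 'I_M.+1} | \sum_i (f i).2 <= k * p]|
   <= 2 ^ (k.+2 * p))%N.
Proof.
set S := [pred f | _].
have sumw : (\sum_(x : bool * 'I_M.+1) 2 ^ (M - x.2) <= 2 ^ M.+2)%N.
  rewrite -(pair_big xpredT xpredT (fun (b : bool) (j : 'I_M.+1) => 2 ^ (M - j)))%N /=.
  by rewrite big_bool/= addnn -mul2n expnS leq_mul2l sum_pow2_rev orbT.
rewrite -(leq_pmul2r (expn_gt0 2 (M * p))) -sum1_card big_distrl/=.
apply: (@leq_trans (\sum_(f : {ffun 'I_p -> bool * 'I_M.+1} | S f)
    2 ^ (k * p) * \prod_i 2 ^ (M - (f i).2))).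
  apply: leq_sum => f Sf; rewrite mul1n -expn_sum -expnD leq_exp2l//.
  apply: leq_trans (leq_add Sf (leqnn _)); rewrite -big_split/=.
  under eq_bigr do rewrite subnKC -1?ltnS//.
  by rewrite sum_nat_const card_ord mulnC.
apply: (@leq_trans (\sum_(f : {ffun 'I_p -> bool * 'I_M.+1})
    2 ^ (k * p) * \prod_i 2 ^ (M - (f i).2))).
  by rewrite [leqRHS](bigID S)/= leq_addr.
rewrite -big_distrr/= -(bigA_distr_bigA (fun (_ : 'I_p) (x : bool * 'I_M.+1) => 2 ^ (M - x.2)))%N.
rewrite prod_nat_const card_ord.
apply: (@leq_trans (2 ^ (k * p) * (2 ^ M.+2) ^ p)).
  by rewrite leq_mul2l; case: (p) => [|e]; rewrite ?expn0 ?orbT// leq_exp2r// sumw orbT.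
by rewrite -expnM -!expnD leq_exp2l// -!mulnDl leq_mul2r !addSn !addnS addnC leqnn orbT.
Qed.

(* The net consists of the points of the lattice (4 sqrt p)^-1 Z^p lying in the
   unit ball; coordinates are rounded towards 0. *)
Lemma unit_net_exists (R : realType) (p : nat) :
  exists2 S : seq 'rV[R]_p, unit_net S & (size S <= 2 ^ (18 * p))%N.
Proof.
have [->|p0] := posnP p.
  exists [:: 0] => //; split=> [u|u _]; first by rewrite inE => /eqP ->; rewrite hs_norm0 ler01.
  by exists 0; rewrite ?mem_head// [u - 0]thinmx0 hs_norm0 invr_ge0.
have pR : 0 < (p%:R : R) by rewrite ltr0n.
pose s : R := 4 * Num.sqrt p%:R.
have s0 : 0 < s by rewrite mulr_gt0// sqrtr_gt0.
have s2 : s ^+ 2 = 16 * p%:R by rewrite exprMn sqr_sqrtr ?ltW//; ring.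
(* For [|u_i| <= 1] the rounded coordinate is at most [s = 4 sqrt p <= 4 p]. A coordinate is stored
   as a sign and an absolute value. *)
pose M := (4 * p)%N.
pose D := {ffun 'I_p -> bool * 'I_M.+1}.
pose vec (f : D) : 'rV[R]_p := \row_i ((-1) ^+ (f i).1 * (f i).2%:R / s).
pose Q := [pred f : D | \sum_i (f i).2 ^ 2 <= 16 * p]%N.
exists [seq vec f | f <- enum Q]; last first.
  (* Natural numbers satisfy [j <= j ^ 2], so the Euclidean condition implies the linear one counted
     with [k = 16]; the exponent is then [16 + 2 = 18]. *)
  rewrite size_map -cardE (leq_trans _ (card_lattice_ball p 16 M))//.
  apply/subset_leq_card/fintype.subsetP => f; rewrite !inE; apply: leq_trans.
  by apply: leq_sum => i _; case: (nat_of_ord _) => // j; rewrite expnS leq_pmulr// expn_gt0.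
split=> [_ /mapP[f + ->]|u u1].
  rewrite mem_enum inE => Qf; apply: hs_norm_le => //; rewrite big_ord1 expr1n.
  under eq_bigr do rewrite mxE !exprMn -exprM mulnC exprM sqrrN expr1n expr1n mul1r exprVn s2.
  rewrite -mulr_suml ler_pdivrMr ?mulr_gt0// mul1r -[16]/(16%:R) -natrM.
  by under eq_bigr do rewrite -natrX; rewrite -natr_sum ler_nat.
have uS : \sum_i (s * `|u 0 i|) ^+ 2 <= (16 * p)%:R.
  under eq_bigr do rewrite exprMn real_normK ?num_real//.
  rewrite -mulr_sumr s2 natrM -[leRHS]mulr1 ler_wpM2l ?mulr_ge0//.
  have <- : hs_norm u ^+ 2 = \sum_i u 0 i ^+ 2 by rewrite hs_norm_sqr big_ord1.
  by rewrite expr_le1 ?hs_norm_ge0.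
have tr i : (Num.truncn (s * `|u 0 i|))%:R <= s * `|u 0 i|.
  by rewrite truncn_le mulr_ge0// ltW.
have trM i : (Num.truncn (s * `|u 0 i|)%R < M.+1)%N.
  rewrite ltnS -(ler_nat R) (le_trans (tr i))//.
  apply: (@le_trans _ _ s).
    by rewrite ler_piMr ?(ltW s0)// (le_trans (hs_norm_entry _ _ _)).
  rewrite /s /M natrM ler_wpM2l// -ler_sqr ?nnegrE ?sqrtr_ge0// sqr_sqrtr ?(ltW pR)//.
  by rewrite -natrX ler_nat expnS leq_pmulr// expn_gt0 p0.
pose f : D := [ffun i => (u 0 i < 0, Ordinal (trM i))].
exists (vec f).
  apply/map_f; rewrite mem_enum inE -(ler_nat R) (le_trans _ uS)//.
  rewrite natr_sum; apply: ler_sum => i _; rewrite ffunE /= natrX.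
  by rewrite ler_sqr ?nnegrE ?mulr_ge0 ?(ltW s0).
apply: hs_norm_le; first by rewrite invr_ge0.
(* Each coordinate is off by at most [1 / s], and [p / s ^ 2 = 1 / 16] is the square of the mesh
   [1 / 4]. *)
rewrite big_ord1; apply: (@le_trans _ _ (\sum_(i < p) (s ^+ 2)^-1)).
  apply: ler_sum => i _; rewrite !mxE ffunE /=.
  have := tr i; have := truncnS_gt (s * `|u 0 i|); rewrite -natr1.
  set k := (Num.truncn _)%:R => k1 k2.
  have -> : u 0 i - (-1) ^+ (u 0 i < 0)%R * k / s
          = (-1) ^+ (u 0 i < 0)%R * ((s * `|u 0 i| - k) / s).
    rewrite [X in X - _](_ : _ = (-1) ^+ (u 0 i < 0)%R * `|u 0 i|); last first.
      by rewrite -realEsign// num_real.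
    by field; rewrite gt_eqF.
  rewrite exprMn -exprM mulnC exprM sqrrN expr1n expr1n mul1r expr_div_n.
  rewrite ler_piMl ?invr_ge0 ?sqr_ge0//.
  rewrite expr_le1//; lra.
rewrite sumr_const card_ord s2 -[_ *+ p]mulr_natr le_eqVlt; apply/orP; left; apply/eqP.
by field; rewrite gt_eqF.
Qed.

Definition net (R : realType) (p : nat) : seq 'rV[R]_p := sval (cid2 (unit_net_exists R p)).

Lemma net_unit (R : realType) p : unit_net (net R p).
Proof. by rewrite /net; case: cid2. Qed.

Lemma net_hs_norm (R : realType) p (u : 'rV[R]_p) : u \in net R p -> hs_norm u <= 1.
Proof. by have [+ _] := net_unit R p; apply. Qed.

Lemma size_net (R : realType) p : (size (net R p) <= 2 ^ (18 * p))%N.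
Proof. by rewrite /net; case: cid2. Qed.

(** A finite surrogate for the operator norm: it involves finitely many pairs [(u, v)], so it
    defines a measurable event open to a union bound, and it controls the operator norm up to a
    factor 2. *)
Definition net_bounded (R : realType) p q (K : R) (A : 'M[R]_(p, q)) : Prop :=
  forall u v, u \in net R p -> v \in net R q -> `|bilin u A v| <= K.

Lemma net_bounded_op (R : realType) p q (K : R) (A : 'M[R]_(p, q)) :
  net_bounded K A -> op_bound A (2 * K).
Proof. exact: op_bound_net (net_unit R p) (net_unit R q). Qed.

(** * Tails, moments and medians *)

Section Tails.
Context {R : realType} {d : measure_display} {T : measurableType d} (P : probability T R).

Lemma measurable_set_le (f g : T -> R) : measurable_fun setT f -> measurable_fun setT g ->
  measurable [set w | f w <= g w].
Proof.
move=> mf mg; rewrite -[X in measurable X]setTI.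
rewrite (_ : [set w | f w <= g w] = (fun w => f w <= g w) @^-1` [set true]).
  by apply: (measurable_fun_ler mf mg) => //.
by apply/seteqP; split => w /=.
Qed.

Lemma measurable_dev (f : T -> R) (a t : R) : measurable_fun setT f ->
  measurable [set w | t <= `|f w - a|].
Proof.
move=> mf; apply: measurable_set_le => //.
by apply: measurableT_comp => //; apply: measurable_funB.
Qed.

Lemma prob_le_cover2 (A B C : set T) (b c : R) :
  measurable A -> measurable B -> measurable C -> A `<=` B `|` C ->
  (P B <= b%:E)%E -> (P C <= c%:E)%E -> (P A <= (b + c)%:E)%E.
Proof.
move=> mA mB mC ABC Bb Cc; apply: (@le_trans _ _ (P (B `|` C))).
  by rewrite le_measure ?inE//; exact: measurableU.
by rewrite (le_trans (measureU2 _ _ _))// EFinD leeD.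
Qed.

Lemma prob_le_mono (A B : set T) (b : R) :
  measurable A -> measurable B -> A `<=` B -> (P B <= b%:E)%E -> (P A <= b%:E)%E.
Proof. by move=> mA mB AB; apply: le_trans; rewrite le_measure ?inE. Qed.

Lemma prob_le_cover_seq (I : eqType) (s : seq I) (A : set T) (B : I -> set T) (b : R) :
  measurable A -> (forall i, measurable (B i)) ->
  A `<=` [set w | exists2 i, i \in s & B i w] ->
  (forall i, i \in s -> (P (B i) <= b%:E)%E) -> (P A <= ((size s)%:R * b)%:E)%E.
Proof.
move=> mA mB; elim: s A mA => [|i s IH] A mA AB Bb.
  rewrite (_ : A = set0) ?measure0 ?mul0r//.
  by apply/seteqP; split => // w /AB[].
rewrite -[X in (X%:R * _)%:E]/(size s).+1 -nat1r mulrDl mul1r.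
apply: (@prob_le_cover2 A (B i) (A `\` B i)) => //.
- exact: measurableD.
- by move=> w Aw; have [?|?] := pselect (B i w); [left|right].
- by apply: Bb; rewrite mem_head.
apply: IH; first exact: measurableD.
  move=> w [/AB[j]]; rewrite inE => /predU1P[-> //|js Bj _].
  by exists j.
by move=> j js; apply: Bb; rewrite inE js orbT.
Qed.

Lemma sum_invsq_le2 n : \sum_(k < n) (k.+1%:R ^+ 2)^-1 <= 2 :> R.
Proof.
(* The strengthened bound makes the induction telescope, as
   [1 / (x + 1)^2 <= 1 / x - 1 / (x + 1)]. *)
have H k : \sum_(j < k.+1) (j.+1%:R ^+ 2)^-1 <= 2 - k.+1%:R^-1 :> R.
  elim: k => [|k IH]; first by rewrite big_ord1 expr1n invr1; lra.
  rewrite big_ord_recr/= (le_trans (lerD IH (lexx _)))//.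
  set x : R := k.+1%:R; have x0 : 0 < x by rewrite ltr0n.
  rewrite -(natr1 k.+1) -/x -lerBrDl.
  suff -> : 2 - (x + 1)^-1 - (2 - x^-1) = (x * (x + 1))^-1.
    by rewrite lef_pV2 ?posrE ?exprn_gt0 ?mulr_gt0 ?addr_gt0// expr2 ler_wpM2r; lra.
  by field; rewrite !gt_eqF// addr_gt0.
case: n => [|n]; first by rewrite big_ord0.
by rewrite (le_trans (H n))// lerBlDr lerDl invr_ge0.
Qed.

(** Discrete layer-cake formula: [Y] is at most [s] times the number of [k >= 0] with [k s <= Y].
    The term [k = 0] contributes at most 1 and the others at most [D] times the sum of [1 / k^2],
    hence [2 D]. *)
Lemma integral_le_tail (Y : T -> R) (s D : R) :
  measurable_fun setT Y -> (forall w, 0 <= Y w) -> 0 < s -> 0 <= D ->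
  (forall k, (0 < k)%N -> (P [set w | (k%:R * s <= Y w)%R] <= (D / k%:R ^+ 2)%:E)%E) ->
  (\int[P]_w (Y w)%:E <= (s * (1 + 2 * D))%:E)%E.
Proof.
move=> mY Y0 s0 D0 tail.
pose A k := [set w | k%:R * s <= Y w].
have mA k : measurable (A k) by apply: measurable_set_le.
have mind k : measurable_fun [set: T] (fun w => (s * \1_(A k) w)%:E).
  by apply/measurable_EFinP/measurable_funM => //; exact: measurable_indic.
have ge0 k w : (0 <= (s * \1_(A k) w)%:E)%E.
  by rewrite lee_fin mulr_ge0// ltW.
have YA w : ((Y w)%:E <= \sum_(0 <= k <oo) (s * \1_(A k) w)%:E)%E.
  pose n := (Num.truncn (Y w / s)).+1.
  apply: le_trans (nneseries_lim_ge n _); last by move=> k _ _; exact: ge0.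
  rewrite sumEFin lee_fin big_mkord.
  rewrite (eq_bigr (fun=> s)) => [|k _].
    rewrite sumr_const card_ord -mulr_natl -ler_pdivrMr// ltW//.
    by rewrite /n truncnS_gt.
  rewrite indicE mem_set ?mulr1//= /A/=.
  rewrite -ler_pdivlMr// (le_trans _ (_ : (Num.truncn (Y w / s))%:R <= _))//.
    by rewrite ler_nat -ltnS ltn_ord.
  by rewrite truncn_le divr_ge0// ltW.
apply: (@le_trans _ _ (\int[P]_w \sum_(0 <= k <oo) (s * \1_(A k) w)%:E)%E).
  apply: ge0_le_integral => //.
  - by move=> w _; rewrite lee_fin.
  - exact/measurable_EFinP.
  - by apply: ge0_emeasurable_sum => // k w _ _; exact: ge0.
rewrite integral_nneseries//.
apply: lime_le; first by apply: is_cvg_nneseries => k _ _; apply: integral_ge0 => w _.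
apply: nearW => n; rewrite big_mkord.
have intE k : (\int[P]_w (s * \1_(A k) w)%:E = s%:E * P (A k))%E.
  under eq_integral do rewrite EFinM.
  rewrite ge0_integralZl_EFin ?integral_indic ?setIT ?(ltW s0)//.
  by apply/measurable_EFinP; exact: measurable_indic.
rewrite (eq_bigr _ (fun (k : 'I_n) _ => intE k)) -ge0_sume_distrr//.
rewrite EFinM lee_pmul2l//; case: n => [|n].
  by rewrite big_ord0 lee_fin addr_ge0// mulr_ge0.
rewrite big_ord_recl/= EFinD leeD//; first exact: probability_le1.
apply: (@le_trans _ _ (\sum_(k < n) (D / k.+1%:R ^+ 2)%:E)%E).
  by apply: lee_sum => k _; exact: tail.
by rewrite sumEFin lee_fin -mulr_sumr mulrC ler_wpM2r// sum_invsq_le2.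
Qed.

(** The median is the infimum of the points where the distribution function reaches 1/2. Right
    continuity gives the lower half, and continuity of [P] along increasing events gives
    [P (f < m) <= 1/2]. The concentration hypothesis speaks only about medians, so one must be
    produced before it can be used. *)
Lemma median_exists (f : T -> R) : measurable_fun setT f -> exists m, is_median P f m.
Proof.
move=> mf.
pose X : {RV P >-> R} := HB.pack f (isMeasurableFun.Build _ _ _ _ f mf).
have cdfE r : cdf X r = P [set w | f w <= r].
  by rewrite /cdf/= /distribution/= /pushforward; congr (P _); apply/seteqP; split => w /=;
    rewrite in_itv.
have mle r : measurable [set w | f w <= r] by exact: measurable_set_le.
pose S := [set r : R | (2^-1%:E <= cdf X r)%E].
have half1 : (2^-1%:E < 1%:E :> \bar R)%E by rewrite lte_fin; lra.
have half0 : (0%:E < 2^-1%:E :> \bar R)%E by rewrite lte_fin; lra.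
have [r1 r1S] : S !=set0.
  apply/set0P/negP => /eqP S0.
  suff : (1%:E <= 2^-1%:E :> \bar R)%E by rewrite leNgt half1.
  apply: (cvge_le _ (cvg_cdfy1 X)); apply: nearW => r.
  by rewrite leNgt; apply/negP => /ltW rS; have : S r by []; rewrite S0.
have [r0 r0S] : exists r0, (cdf X r0 < 2^-1%:E)%E.
  apply: contrapT => /forallNP H.
  suff : (2^-1%:E <= 0%:E :> \bar R)%E by rewrite leNgt half0.
  apply: (cvge_ge _ (cvg_cdfNy0 X)); apply: nearW => r.
  by rewrite leNgt; apply/negP.
have lbS : lbound S r0.
  move=> r rS; rewrite leNgt; apply/negP => rr0.
  by have := le_lt_trans (le_trans rS (cdf_nondecreasing X (ltW rr0))) r0S; rewrite ltxx.
have infS : has_inf S by split; [exists r1|exists r0].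
pose m := inf S; exists m.
have gtm r : m < r -> (2^-1%:E <= cdf X r)%E.
  rewrite -subr_gt0 => mr; have [x xS xr] := inf_adherent mr infS.
  apply: le_trans xS _; apply: cdf_nondecreasing; rewrite ltW//.
  by move: xr; rewrite -/m addrC subrK.
split.
  rewrite -cdfE; apply: (cvge_ge _ (@cdf_right_continuous _ _ _ _ X m)).
  by near=> x; apply: gtm; near: x; exact: nbhs_right_gt.
have mlt : measurable [set w | f w < m].
  rewrite (_ : [set w | f w < m] = ~` [set w | m <= f w]).
    by apply: measurableC; exact: measurable_set_le.
  by apply/seteqP; split => w /=; rewrite ltNge => /negP.
suff Plt : (P [set w | (f w < m)%R] <= 2^-1%:E)%E.
  rewrite (_ : [set w | m <= f w] = ~` [set w | f w < m]); last first.
    by apply/seteqP; split => w /=; rewrite leNgt => /negP.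
  rewrite probability_setC// leeBrDr ?fin_num_measure//.
  by rewrite (le_trans (leeD (lexx _) Plt))// -EFinD lee_fin; lra.
pose F k := [set w | f w <= m - k.+1%:R^-1].
have UF : \bigcup_k F k = [set w | f w < m].
  apply/seteqP; split => w /=.
    by move=> [k _ /= /le_lt_trans]; apply; rewrite ltrBlDr ltrDl invr_gt0.
  rewrite -subr_gt0 => /ltr_add_invr => -[k]; rewrite add0r => hk; exists k => //.
  by rewrite /F/= lerBrDr -lerBrDl ltW.
have := @nondecreasing_cvg_mu _ _ _ P F; rewrite UF => /(_ _ mlt) h.
have {}h : P (F k) @[k --> \oo] --> P [set w | f w < m].
  apply: h => [k|k l kl]; first exact: mle.
  apply/subsetPset => w /= /le_trans; apply; rewrite lerD2l lerN2.
  by rewrite lef_pV2 ?posrE// ler_nat.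
apply: (cvge_le _ h); apply: nearW => k; rewrite -cdfE.
rewrite leNgt; apply/negP => /ltW kS.
have := ge_inf (ex_intro _ r0 lbS) kS; rewrite -/m lerBrDr gerDl.
by rewrite leNgt invr_gt0 ltr0n.
Unshelve. all: by end_near. Qed.

End Tails.

(** * Moving a tail bound from an arbitrary centre to the mean *)

Section TailCentering.
Context {R : realType}.

(** With [c' = c / (2 K + 1)]: if [c' x <= 1/2], the right-hand side is at least 1; otherwise
    [K <= 2 K c' x], and part of the exponent absorbs [K]. *)
Lemma prefactor2 (K c p x : R) : 0 <= K -> 0 < c -> 0 <= x ->
  p <= 1 -> p <= K * expR (- (c * x)) -> p <= 2 * expR (- (c / (2 * K + 1) * x)).
Proof.
move=> K0 c0 x0 p1 pK; set c' := c / (2 * K + 1).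
have K1 : 0 < 2 * K + 1 by rewrite ltr_wpDl// mulr_ge0.
have cE : c = (2 * K + 1) * c' by rewrite /c'; field; rewrite gt_eqF.
have c'0 : 0 < c' by rewrite divr_gt0.
have [h|h] := leP (c' * x) 2^-1.
  by have := expR_ge1Dx (- (c' * x)); lra.
apply: (le_trans pK).
have -> : - (c * x) = - (2 * K * (c' * x)) + - (c' * x) by rewrite cE; ring.
rewrite expRD mulrA ler_wpM2r ?expR_ge0//.
rewrite expRN ler_pdivrMr ?expR_gt0//.
have := expR_ge1Dx (2 * K * (c' * x)).
have : K <= 2 * K * (c' * x) by rewrite -mulrA mulrCA ler_peMr//; lra.
lra.
Qed.

(** For [L = 0] and [t >= 0] this is the Gaussian rate [t ^ 2], so that a single subgaussian matrix
    is covered by the same recentering lemma as the network. *)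
Definition rate (L : nat) (t : R) : R := Order.min (t ^+ 2) (t `^ (2 / L.+1%:R)).

Lemma rate_exponent (L : nat) : 0 < (2 / L.+1%:R : R) <= 2.
Proof.
rewrite divr_gt0//= ler_pdivrMr// ler_peMr// -[1]/(1%:R) ler_nat//.
Qed.

Lemma rate_ge0 L t : 0 <= rate L t.
Proof. by rewrite le_min sqr_ge0 powR_ge0. Qed.

Lemma rate0 (t : R) : 0 <= t -> rate 0 t = t ^+ 2.
Proof. by move=> t0; rewrite /rate divr1 powR_mulrn// minxx. Qed.

Lemma rate_half L t : 0 <= t -> rate L t / 4 <= rate L (t / 2).
Proof.
move=> t0; rewrite /rate le_min; apply/andP; split.
  rewrite expr_div_n -[2 ^+ 2]/(2 * 2) -natrM ler_pM2r// ge_min lexx//.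
apply: (@le_trans _ _ (t `^ (2 / L.+1%:R) / 4)).
  by rewrite ler_pM2r// ge_min lexx orbT.
rewrite powRM// ler_wpM2l ?powR_ge0//.
have /andP[_ e2] := rate_exponent L.
have -> : 4^-1 = (2^-1 : R) `^ 2%:R by rewrite powR_mulrn//; field.
by apply: ger_powR => //; lra.
Qed.

(** On the power branch the loss is [m ^ (1 / (L + 1)) <= m], which is where [1 <= m] enters. Tails
    sampled at multiples of [m ^ (-1/2)] are thus summable uniformly in [m]. *)
Lemma rate_integer L (k : nat) (m : R) : (0 < k)%N -> 1 <= m ->
  k%:R `^ (2 / L.+1%:R) <= m * rate L (k%:R * (Num.sqrt m)^-1).
Proof.
move=> k0 m1; have m0 : 0 < m by lra.
have k1 : 1 <= k%:R :> R by rewrite ler1n.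
have s0 : 0 < Num.sqrt m by rewrite sqrtr_gt0.
have /andP[e0 e2] := rate_exponent L.
rewrite /rate minr_pMr ?(ltW m0)// le_min; apply/andP; split.
  rewrite exprMn exprVn sqr_sqrtr ?(ltW m0)// mulrCA mulfV ?gt_eqF// mulr1.
  by rewrite -powR_mulrn ?(le_trans _ k1)//; exact: ler_powR.
rewrite powRM ?invr_ge0 ?(ltW s0)// mulrCA ler_peMr ?powR_ge0//.
rewrite -[(Num.sqrt m)^-1]powR_inv1 ?(ltW s0)// -powRrM mulN1r powRN ler_pdivlMr ?powR_gt0// mul1r.
rewrite -[leRHS]sqr_sqrtr ?(ltW m0)// -powR_mulrn ?(ltW s0)//.
apply: ler_powR => //.
by rewrite -[leLHS]sqrtr1 ler_sqrt// ltW.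
Qed.

(** Raising [exp (y / (L + 1)) >= y / (L + 1)] to the power [L + 1] turns [k ^ (2 / (L + 1))] into
    the summable order [k ^ 2]. *)
Lemma expRN_powR_le L (c : R) (k : nat) : 0 < c -> (0 < k)%N ->
  expR (- (c * k%:R `^ (2 / L.+1%:R))) <= (L.+1%:R / c) ^+ L.+1 / k%:R ^+ 2.
Proof.
move=> c0 k0; set y := c * _.
have kp : 0 < k%:R :> R by rewrite ltr0n.
have y0 : 0 < y by rewrite mulr_gt0// powR_gt0.
have -> : (L.+1%:R / c) ^+ L.+1 / k%:R ^+ 2 = ((y / L.+1%:R) ^+ L.+1)^-1.
  have kE : (k%:R `^ (2 / L.+1%:R)) ^+ L.+1 = k%:R ^+ 2 :> R.
    by rewrite -powR_mulrn ?powR_ge0// -powRrM divfK// powR_mulrn ?(ltW kp).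
  rewrite /y mulrAC [(_ * k%:R `^ _) ^+ _]exprMn kE -[L.+1%:R / c]invf_div exprVn.
  by rewrite -invfM.
rewrite expRN lef_pV2 ?posrE ?expR_gt0 ?exprn_gt0 ?divr_gt0//.
have -> : expR y = expR (y / L.+1%:R) ^+ L.+1.
  by rewrite -expRM_natr divfK.
by rewrite lerXn2r ?nnegrE ?expR_ge0 ?divr_ge0 ?(ltW y0)// (le_trans _ (expR_ge1Dx _))// lerDr.
Qed.

(** Integrating the tail gives [E |Y - a| <= s M] with [s = m ^ (-1/2)], so the mean lies within
    [s M] of [a]. For [t > 2 s M], a deviation [t] from the mean forces a deviation [t / 2] from
    [a]; for smaller [t] the claimed bound is at least 1. The constant is chosen before the
    probability space and [m], as uniformity in the widths requires. *)
Lemma tail_recenter (L : nat) (C c : R) : 0 <= C -> 0 < c -> exists2 c' : R, 0 < c' &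
  forall (d : measure_display) (T : measurableType d) (P : probability T R)
    (m : R) (Y : T -> R) (a : R), 1 <= m -> measurable_fun setT Y ->
  (forall t, 0 < t ->
    (P [set w | (t <= `|Y w - a|)%R] <= (C * expR (- (c * (m * rate L t))))%:E)%E) ->
  P.-integrable setT (EFin \o Y) /\
  (forall t, 0 < t -> (P [set w | (t <= `|Y w - \int[P]_x Y x|)%R]
     <= (2 * expR (- (c' * (m * rate L t))))%:E)%E).
Proof.
move=> C0 c0.
pose D := C * (L.+1%:R / c) ^+ L.+1.
have D0 : 0 <= D by rewrite mulr_ge0// exprn_ge0// divr_ge0// ltW.
pose M := 1 + 2 * D; have M0 : 0 < M by rewrite ltr_wpDr// mulr_ge0.
have K1 : 0 < 2 * C + 1 by rewrite ltr_wpDl// mulr_ge0.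
(* The 4 pays for replacing [t] by [t / 2] in [rate], and [2 * C + 1] for reducing the prefactor to
   2. Below, [c2] is such that [c2 (2 M)^2 = 1/2]. *)
pose c1 := c / 4 / (2 * C + 1).
pose c2 := (8 * M ^+ 2)^-1.
have c10 : 0 < c1 by rewrite !divr_gt0.
have c20 : 0 < c2 by rewrite invr_gt0 mulr_gt0// exprn_gt0.
exists (Order.min c1 c2); first by rewrite lt_min c10.
move=> d T P m Y a m1 mY tail; have m0 : 0 < m by lra.
pose s := (Num.sqrt m)^-1; have s0 : 0 < s by rewrite invr_gt0 sqrtr_gt0.
have s2 : m * s ^+ 2 = 1 by rewrite exprVn sqr_sqrtr ?(ltW m0)// mulfV ?gt_eqF.
have mYa : measurable_fun setT (fun w => `|Y w - a|).
  by apply: measurableT_comp => //; exact: measurable_funB.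
have mean_dev : (\int[P]_w (`|Y w - a|)%:E <= (s * M)%:E)%E.
  apply: integral_le_tail => // k k0; have kp : 0 < k%:R :> R by rewrite ltr0n.
  apply: (le_trans (tail _ (mulr_gt0 kp s0))); rewrite lee_fin /D -mulrA ler_wpM2l//.
  apply: le_trans (expRN_powR_le L c0 k0).
  by rewrite ler_expR lerN2 ler_pM2l// rate_integer.
have intYa : P.-integrable setT (EFin \o (fun w => Y w - a)).
  apply/integrableP; split; first by apply/measurable_EFinP; exact: measurable_funB.
  by rewrite (le_lt_trans mean_dev)// ltry.
have intY : P.-integrable setT (EFin \o Y).
  have := integrableD measurableT intYa (finite_measure_integrable_cst P a measurableT).
  by apply: eq_integrable => // w _ /=; rewrite -EFinD subrK.
split=> // t t0; set mu := \int[P]_x Y x.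
have mua : `|mu - a| <= s * M.
  have -> : mu - a = \int[P]_x (Y x - a).
    rewrite RintegralB//; last exact: finite_measure_integrable_cst.
    by rewrite Rintegral_cst // [X in fine X](_ : _ = 1%E) ?mulr1 //; exact: probability_setT.
  rewrite -lee_fin (le_trans _ mean_dev)// EFin_normr_Rintegral//.
  exact: le_abse_integral (measurable_int _ intYa).
set A := [set w | _]; have mA : measurable A by exact: measurable_dev.
have PA1 : fine (P A) <= 1 by rewrite -lee_fin fineK ?fin_num_measure// probability_le1.
rewrite -[P A]fineK ?fin_num_measure// lee_fin.
have x0 : 0 <= m * rate L t by rewrite mulr_ge0 ?rate_ge0// ltW.
have weaken c3 : Order.min c1 c2 <= c3 ->
    2 * expR (- (c3 * (m * rate L t))) <= 2 * expR (- (Order.min c1 c2 * (m * rate L t))).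
  by move=> h; rewrite ler_pM2l// ler_expR lerN2 ler_wpM2r.
have [t_small|t_large] := leP t (2 * (s * M)).
  apply: le_trans (weaken c2 _); last by rewrite ge_min lexx orbT.
  have : m * rate L t <= 4 * M ^+ 2.
    apply: (@le_trans _ _ (m * (2 * (s * M)) ^+ 2)); last first.
      by rewrite !exprMn mulrCA [m * (_ * _)]mulrA s2 mul1r; lra.
    rewrite ler_pM2l// (le_trans _ (_ : t ^+ 2 <= _))//; first by rewrite ge_min lexx.
    by rewrite lerXn2r ?nnegrE ?(ltW t0)// !mulr_ge0// ltW.
  rewrite -(ler_pM2l c20).
  have -> : c2 * (4 * M ^+ 2) = 2^-1 by rewrite /c2; field; rewrite gt_eqF.
  by have := expR_ge1Dx (- (c2 * (m * rate L t))); lra.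
apply: le_trans (weaken c1 _); last by rewrite ge_min lexx.
apply: prefactor2 => //; first by rewrite divr_gt0.
rewrite -lee_fin fineK ?fin_num_measure//.
apply: (@le_trans _ _ (P [set w | (t / 2 <= `|Y w - a|)%R])).
  rewrite le_measure ?inE//; first exact: measurable_dev.
  move=> w; rewrite /A/= => tw.
  have := ler_normD (Y w - a) (a - mu); rewrite addrA subrK (distrC a).
  by move: tw mua t_large; lra.
apply: (le_trans (tail _ _)); first by rewrite divr_gt0.
rewrite lee_fin ler_wpM2l// ler_expR lerN2 -mulrA ler_pM2l//.
by rewrite mulrCA ler_pM2l// mulrC rate_half// ltW.
Qed.

End TailCentering.

(** * Measurability and independence *)

Lemma measurable_fun_countable d (T : measurableType d) (U : countType) d'
    (V : measurableType d') (h : T -> U) (g : U -> V) :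
  (forall u, measurable [set w | h w = u]) -> measurable_fun setT (g \o h).
Proof.
move=> mh _ B mB; rewrite setTI.
rewrite (_ : _ @^-1` B = \bigcup_u (if pselect (B (g u)) then [set w | h w = u] else set0)).
  apply: countable_bigcupT_measurable => [|u]; first exact: countableP.
  by case: pselect => ? /=; [exact: mh|exact: measurable0].
apply/seteqP; split => [w /= Bw|w [u _]].
  by exists (h w) => //; case: pselect.
by case: pselect => //= Bu ->.
Qed.

Section MatrixMeasurability.
Context {R : realType} {d : measure_display} {T : measurableType d}.

Lemma measurable_floor_eq (f : T -> R) (z : int) : measurable_fun setT f ->
  measurable [set w | Num.floor (f w) = z].
Proof.
move=> mf; rewrite (_ : [set w | _] = [set w | z%:~R <= f w] `\` [set w | (z + 1)%:~R <= f w]).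
  by apply: measurableD; exact: measurable_set_le.
apply/seteqP; split => w /=.
  by move=> <-; split; [exact: floor_le|apply/negP; rewrite -ltNge floorD1_gt].
by move=> [z1 /negP]; rewrite -ltNge => z2; apply: floor_def; rewrite z1.
Qed.

Lemma hs_norm_le_entries p q (A : 'M[R]_(p, q)) (e : R) : 0 <= e ->
  (forall i j, `|A i j| <= e) -> hs_norm A <= Num.sqrt (p * q)%:R * e.
Proof.
move=> e0 Ae; apply: hs_norm_le; first by rewrite mulr_ge0 ?sqrtr_ge0.
rewrite exprMn sqr_sqrtr// natrM -mulrA.
apply: (@le_trans _ _ (\sum_(i < p) \sum_(j < q) e ^+ 2)).
  apply: ler_sum => i _; apply: ler_sum => j _.
  by rewrite -[leLHS]real_normK ?num_real// lerXn2r ?nnegrE.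
by rewrite !sumr_const !card_ord -[_ *+ p]mulr_natl -[_ *+ q]mulr_natl.
Qed.

(** Rounding the entries of [Y] down to the grid of mesh [1 / (m + 1)] leaves countably many values,
    so [G] of the rounded matrix is measurable; the Lipschitz bound gives pointwise convergence to
    [G \o Y]. *)
Lemma measurable_hs_lipschitz p q (k : R) (G : 'M[R]_(p, q) -> R) (Y : T -> 'M[R]_(p, q)) :
  hs_lipschitz k G -> random_mx Y -> measurable_fun setT (G \o Y).
Proof.
move=> Gk mY.
pose fl (m : nat) w : 'M[int]_(p, q) := \matrix_(i, j) Num.floor (m.+1%:R * Y w i j).
pose up (m : nat) (Z : 'M[int]_(p, q)) : 'M[R]_(p, q) := \matrix_(i, j) ((Z i j)%:~R / m.+1%:R).
apply: (@measurable_fun_cvg _ _ _ _ (fun m => (G \o up m) \o fl m)).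
  move=> m; apply: measurable_fun_countable => Z.
  rewrite (_ : [set w | _] = \bigcap_(i : 'I_p) \bigcap_(j : 'I_q)
     [set w | Num.floor (m.+1%:R * Y w i j) = Z i j]).
    apply: fin_bigcap_measurable => // i _; apply: fin_bigcap_measurable => // j _.
    by apply: measurable_floor_eq; apply: measurable_funM.
  apply/seteqP; split => w /=.
    by move=> <- i _ j _; rewrite /= mxE.
  by move=> H; apply/matrixP => i j; rewrite mxE; exact: H.
move=> w _; apply/cvgrPdist_le => /= e e0.
pose K := `|k| * Num.sqrt (p * q)%:R.
have K0 : 0 <= K by rewrite mulr_ge0 ?sqrtr_ge0.
near=> m; have m0 : 0 < m.+1%:R :> R by rewrite ltr0n.
apply: (le_trans (Gk _ _)); apply: (@le_trans _ _ (K / m.+1%:R)).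
  rewrite (le_trans (ler_wpM2r (hs_norm_ge0 _) (ler_norm k)))// -mulrA ler_wpM2l//.
  apply: hs_norm_le_entries => [|i j]; first by rewrite invr_ge0.
  rewrite !mxE; set x := m.+1%:R * Y w i j.
  have -> : Y w i j = m.+1%:R^-1 * x by rewrite mulKf ?gt_eqF.
  rewrite [_^-1 * x]mulrC -mulrBl normrM [`|_^-1|]ger0_norm ?invr_ge0// ler_piMl ?invr_ge0//.
  by have := floor_le x; have := floorD1_gt x; rewrite intrD ler_norml; lra.
rewrite ler_pdivrMr// mulrC -ler_pdivrMr//.
rewrite (@le_trans _ _ m%:R) ?ler_nat//.
by near: m; exact: nbhs_infty_ger.
Unshelve. all: by end_near. Qed.
End MatrixMeasurability.

Section Independence.
Context {R : realType} {d : measure_display} {T : measurableType d} (P : probability T R).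
Implicit Types (A B : set T) (G : set (set T)).

Lemma sigma_algebra_sub_measurable G : G `<=` measurable -> <<s G >> `<=` @measurable _ T.
Proof. by move=> Gm; apply: smallest_sub => //; exact: sigma_algebra_measurable. Qed.

(** Dynkin's pi-lambda argument: for a fixed [B], the product formula is stable under complements
    and countable disjoint unions. *)
Lemma indep_sigma_algebra_l G B : G `<=` measurable -> setI_closed G -> measurable B ->
  (forall A, G A -> P (A `&` B) = (P A * P B)%E) ->
  forall A, <<s G >> A -> P (A `&` B) = (P A * P B)%E.
Proof.
move=> Gm GI mB GB.
have sGm : forall A, <<s G >> A -> measurable A by exact: sigma_algebra_sub_measurable.
have indepC A : measurable A -> P (A `&` B) = (P A * P B)%E ->
    P (~` A `&` B) = (P (~` A) * P B)%E.
  move=> mA PAB.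
  have -> : P (~` A `&` B) = (P B - P (A `&` B))%E.
    rewrite [~` A `&` B]setIC -setDE [A `&` B]setIC measureD//.
    by rewrite (le_lt_trans (probability_le1 _ _)) ?ltry.
  by rewrite PAB probability_setC// muleBl ?fin_num_measure ?mul1e//.
have indep_bigcup (F : (set T)^nat) : (forall n, measurable (F n)) -> trivIset setT F ->
    (forall n, P (F n `&` B) = (P (F n) * P B)%E) ->
    P (\bigcup_k F k `&` B) = (P (\bigcup_k F k) * P B)%E.
  move=> mF tF PF.
  have -> : P (\bigcup_k F k `&` B) = (\sum_(0 <= k <oo) P (F k `&` B))%E.
    rewrite setI_bigcupl measure_bigcup//.
    - by apply: eq_eseriesl => k; rewrite in_setT.
    - by move=> k _; exact: measurableI.
    - by apply: trivIset_setIr.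
  have -> : P (\bigcup_k F k) = (\sum_(0 <= k <oo) P (F k))%E.
    by rewrite measure_bigcup//; apply: eq_eseriesl => k; rewrite in_setT.
  rewrite -[P B]fineK ?fin_num_measure// muleC -nneseriesZl//.
  by apply: eq_eseriesr => k _; rewrite PF muleC fineK ?fin_num_measure.
apply: (@dynkin_induction _ (g_sigma_algebraType G) G) => //.
- by rewrite setTI probability_setT mul1e.
- by move=> A mA; apply: indepC; exact: sGm.
- by move=> F mF tF PF; apply: indep_bigcup => // k; apply: sGm; exact: mF.
Qed.

Lemma indep_sigma_algebra G1 G2 : G1 `<=` measurable -> G2 `<=` measurable ->
  setI_closed G1 -> setI_closed G2 ->
  (forall A B, G1 A -> G2 B -> P (A `&` B) = (P A * P B)%E) ->
  forall A B, <<s G1 >> A -> <<s G2 >> B -> P (A `&` B) = (P A * P B)%E.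
Proof.
move=> G1m G2m G1I G2I G12 A B sA sB.
have mB : measurable B by exact: (sigma_algebra_sub_measurable G2m).
apply: (indep_sigma_algebra_l G1m G1I mB) => // {sA}A GA.
rewrite setIC muleC; apply: (indep_sigma_algebra_l G2m G2I) sB => //; first exact: G1m.
by move=> C GC; rewrite setIC muleC G12.
Qed.

(* The image of P under the diagonal map w |-> (w, w) is the product of the
   restrictions of P to two independent sigma-algebras, so that a bound valid
   for all sections passes to the diagonal. *)
Lemma prob_diagonal_le G1 G2 (b : R) : G1 `<=` measurable -> G2 `<=` measurable ->
  (forall A B, <<s G1 >> A -> <<s G2 >> B -> P (A `&` B) = (P A * P B)%E) ->
  forall S : set (g_sigma_algebraType G1 * g_sigma_algebraType G2), measurable S ->
  (forall w, (P [set w' | S (w, w')] <= b%:E)%E) ->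
  (P [set w | S (w, w)] <= b%:E)%E.
Proof.
move=> G1m G2m G12 S mS Sb.
have s1 := sigma_algebra_sub_measurable G1m; have s2 := sigma_algebra_sub_measurable G2m.
have mf1 : measurable_fun [set: T] (id : T -> g_sigma_algebraType G1).
  by move=> _ A mA; rewrite setTI; exact: s1.
have mf2 : measurable_fun [set: T] (id : T -> g_sigma_algebraType G2).
  by move=> _ A mA; rewrite setTI; exact: s2.
have mD := measurable_fun_pair mf1 mf2.
pose f1 : {mfun T >-> g_sigma_algebraType G1} :=
  HB.pack (id : T -> g_sigma_algebraType G1) (isMeasurableFun.Build _ _ _ _ _ mf1).
pose f2 : {mfun T >-> g_sigma_algebraType G2} :=
  HB.pack (id : T -> g_sigma_algebraType G2) (isMeasurableFun.Build _ _ _ _ _ mf2).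
pose fD : {mfun T >-> (g_sigma_algebraType G1 * g_sigma_algebraType G2)%type} :=
  HB.pack (fun w : T => (w : g_sigma_algebraType G1, w : g_sigma_algebraType G2))
    (isMeasurableFun.Build _ _ _ _ _ mD).
have -> : P [set w | S (w, w)] = distribution P fD S by [].
(* Uniqueness of the product measure asks for agreement on rectangles only, and there it is
   independence. *)
rewrite -(@product_measure_unique _ _ _ _ _ (distribution P f1) (distribution P f2))//.
  rewrite /product_measure1.
  apply: (@le_trans _ _ (\int[distribution P f1]_w b%:E)%E).
    apply: ge0_le_integral => //.
    - by apply: measurable_fun_xsection.
    - move=> w _ /=; rewrite /distribution/= /pushforward.
      rewrite (_ : _ @^-1` _ = [set w' | S (w, w')]); first exact: Sb.
      by apply/seteqP; split => w'; rewrite /= /xsection/= inE.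
  rewrite integral_cst// [X in (_ * X)%E](_ : _ = 1%E) ?mule1//.
  exact: (@probability_setT _ _ _ (distribution P f1)).
Qed.

End Independence.

(** * Lipschitz functions of subgaussian matrices *)

Section LipschitzConcentration.
Context {R : realType}.

Lemma hs_lipschitzZ p q (a k : R) (G : 'M[R]_(p, q) -> R) : 0 <= a ->
  hs_lipschitz k G -> hs_lipschitz (a * k) (fun A => a * G A).
Proof.
by move=> a0 Gk A B; rewrite -mulrBr normrM ger0_norm// -mulrA ler_wpM2l.
Qed.

Lemma random_mx_preimage d (T : measurableType d) p q (Y : T -> 'M[R]_(p, q)) :
  random_mx Y -> forall S, mx_borel S -> measurable (Y @^-1` S).
Proof.
move=> mY; apply: smallest_sub.
  split=> [|S mS|F mF].
  - by rewrite /= preimage_set0.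
  - by rewrite /= setTD preimage_setC; exact: measurableC.
  - by rewrite /= preimage_bigcup; exact: bigcup_measurable.
move=> _ [i [j [B [mB ->]]]] /=.
by rewrite -[X in measurable X]setTI; exact: (mY i j).
Qed.

Lemma mx_borel_lipschitz p q k (G : 'M[R]_(p, q) -> R) B :
  hs_lipschitz k G -> measurable B -> mx_borel (G @^-1` B).
Proof.
move=> Gk mB.
pose gen := [set S | exists (i : 'I_p) (j : 'I_q) (B : set R),
  measurable B /\ S = (fun A : 'M[R]_(p, q) => A i j) @^-1` B].
have := @measurable_hs_lipschitz R _ (g_sigma_algebraType gen) p q k G id Gk.
rewrite -[X in mx_borel X]setTI; apply => // i j _ C mC.
by rewrite setTI; apply: sub_sigma_algebra; exists i, j, C.
Qed.

Section Concentration.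
Context {d : measure_display} {T : measurableType d} (P : probability T R).

(** The half-lines [G <= 0] and [0 <= G] are exchanged by [Y |-> - Y], hence equally likely, and
    together they cover everything. *)
Lemma odd_median0 p q k (G : 'M[R]_(p, q) -> R) (Y : T -> 'M[R]_(p, q)) :
  random_mx Y -> symmetric_law P Y -> hs_lipschitz k G ->
  (forall A, G (- A) = - G A) -> is_median P (fun w => G (Y w)) 0.
Proof.
move=> mY symY Gk Godd.
have mG := measurable_hs_lipschitz Gk mY.
have mle : measurable [set w | G (Y w) <= 0] by exact: measurable_set_le.
have mge : measurable [set w | 0 <= G (Y w)] by exact: measurable_set_le.
have PP : P [set w | G (Y w) <= 0] = P [set w | 0 <= G (Y w)].
  have mS : mx_borel (G @^-1` [set x | x <= 0]).
    apply: (mx_borel_lipschitz Gk).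
    rewrite (_ : [set x | x <= 0] = [set` `]-oo, 0]])//.
  rewrite [LHS](symY _ mS); congr (P _).
  by apply/seteqP; split => w /=; rewrite Godd oppr_le0.
have : (1 <= P [set w | (G (Y w) <= 0)%R] + P [set w | (0 <= G (Y w))%R])%E.
  rewrite -(@probability_setT _ _ _ P).
  apply: le_trans (measureU2 _ _ _) => //.
  rewrite le_measure ?inE//; first exact: measurableU.
  by move=> w _ /=; case: (lerP (G (Y w)) 0) => [?|/ltW]; [left|right].
rewrite /is_median PP -[P _]fineK ?fin_num_measure// -EFinD !lee_fin => h.
by split; lra.
Qed.

Lemma subgaussian_median_tail p q (rho k : R) (Y : T -> 'M[R]_(p, q))
    (G : 'M[R]_(p, q) -> R) m t :
  subgaussian_conc P rho Y -> 0 < k -> hs_lipschitz k G ->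
  is_median P (fun w => G (Y w)) m -> 0 < t ->
  (P [set w | (k * t <= `|G (Y w) - m|)%R] <= (2 * expR (- (t ^+ 2 / rho ^+ 2)))%:E)%E.
Proof.
move=> sub k0 Gk [med1 med2] t0; have ki0 : 0 < k^-1 by rewrite invr_gt0.
have Gk1 : hs_lipschitz 1 (fun A => k^-1 * G A).
  by have := hs_lipschitzZ (ltW ki0) Gk; rewrite mulVf ?gt_eqF.
have := sub _ Gk1 (k^-1 * m) _ _ t0; rewrite mulNr.
rewrite (_ : [set w | _] = [set w | k * t <= `|G (Y w) - m|]); last first.
  apply/seteqP; split => w /=; rewrite -mulrBr normrM gtr0_norm// ler_pdivlMl//.
apply; split.
  rewrite (_ : [set w | _] = [set w | G (Y w) <= m])//.
  by apply/seteqP; split => w /=; rewrite ler_pM2l.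
rewrite (_ : [set w | _] = [set w | m <= G (Y w)])//.
by apply/seteqP; split => w /=; rewrite ler_pM2l.
Qed.

End Concentration.

Lemma subgaussian_mean_tail (rho : R) : 0 < rho -> exists2 c : R, 0 < c &
  forall (d : measure_display) (T : measurableType d) (P : probability T R) p q
    (Y : T -> 'M[R]_(p, q)) (G : 'M[R]_(p, q) -> R) k,
  random_mx Y -> subgaussian_conc P rho Y -> 0 < k -> hs_lipschitz k G ->
  P.-integrable setT (fun w => (G (Y w))%:E) /\
  forall t, 0 < t -> (P [set w | (k * t <= `|G (Y w) - \int[P]_x G (Y x)|)%R]
     <= (2 * expR (- (c * t ^+ 2)))%:E)%E.
Proof.
move=> rho0; have r2 : 0 < (rho ^+ 2)^-1 by rewrite invr_gt0 exprn_gt0.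
(* The Gaussian case of recentering, used below with [m = 1] on the normalised function
   [k^-1 * G]. *)
have [c c0 H] := tail_recenter 0 (ler0n R 2) r2.
exists c => // d T P p q Y G k mY sub k0 Gk.
have mG := measurable_hs_lipschitz Gk mY.
have [m med] := median_exists P mG.
have ki0 : 0 < k^-1 by rewrite invr_gt0.
have devE a t : [set w | t <= `|k^-1 * G (Y w) - k^-1 * a|] =
                [set w | k * t <= `|G (Y w) - a|].
  by apply/seteqP; split => w /=; rewrite -mulrBr normrM gtr0_norm// ler_pdivlMl.
have [|t t0|intG tail] := H _ _ P 1 (fun w => k^-1 * G (Y w)) (k^-1 * m) (lexx _).
- exact: measurable_funM.
- rewrite devE mul1r rate0 ?(ltW t0)// [_^-1 * _]mulrC.
  exact: subgaussian_median_tail.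
have intG' : P.-integrable setT (fun w => (G (Y w))%:E).
  have := integrableZl measurableT k intG.
  by apply: eq_integrable => // w _ /=; rewrite -EFinM mulVKf ?gt_eqF.
split=> // t t0; have := tail _ t0.
by rewrite RintegralZl// devE mul1r rate0// ltW.
Qed.

(** Since 0 is a median, [G ^ 2] exceeds [j k^2] with probability at most [2 exp (- j / rho^2)],
    which is [O(1 / j^2)] and can be summed. The case [k = 0] is separate because the step [k ^ 2]
    of the summation must be positive. *)
Lemma subgaussian_second_moment (rho : R) : 0 < rho -> exists2 M : R, 0 < M &
  forall (d : measure_display) (T : measurableType d) (P : probability T R) p q
    (Y : T -> 'M[R]_(p, q)) (G : 'M[R]_(p, q) -> R) k,
  random_mx Y -> symmetric_law P Y -> subgaussian_conc P rho Y ->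
  0 <= k -> hs_lipschitz k G -> (forall A, G (- A) = - G A) ->
  (\int[P]_w (G (Y w) ^+ 2)%:E <= (k ^+ 2 * M)%:E)%E.
Proof.
move=> rho0; have r2 : 0 < (rho ^+ 2)^-1 by rewrite invr_gt0 exprn_gt0.
pose D : R := 2 * (2 / (rho ^+ 2)^-1) ^+ 2.
have D0 : 0 <= D by rewrite mulr_ge0// sqr_ge0.
exists (1 + 2 * D); first by rewrite ltr_wpDr// mulr_ge0.
move=> d T P p q Y G k mY symY sub k0 Gk Godd.
have mG := measurable_hs_lipschitz Gk mY.
have [kz|kn0] := eqVneq k 0.
  have G0 A : G A = 0.
    have := Gk A (- A); rewrite kz mul0r normr_le0 subr_eq0 Godd => /eqP.
    by lra.
  rewrite integral0_eq ?kz ?expr0n ?mul0r// => w _.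
  by rewrite G0 expr0n.
have kp : 0 < k by rewrite lt_neqAle eq_sym kn0.
have med := odd_median0 mY symY Gk Godd.
apply: integral_le_tail => //.
- exact: measurable_funX.
- by move=> w; exact: sqr_ge0.
- by rewrite exprn_gt0.
move=> j j0; have jp : 0 < j%:R :> R by rewrite ltr0n.
have sj : 0 < Num.sqrt (j%:R : R) by rewrite sqrtr_gt0.
have := subgaussian_median_tail sub kp Gk med sj.
have sqE x : (k * Num.sqrt j%:R <= `|x - 0|) = (j%:R * k ^+ 2 <= x ^+ 2).
  rewrite subr0 -[x ^+ 2]real_normK ?num_real// -[j%:R in RHS]sqr_sqrtr ?(ltW jp)//.
  by rewrite -exprMn ler_sqr ?nnegrE ?mulr_ge0 ?sqrtr_ge0// mulrC.
rewrite (_ : [set w | _] = [set w | j%:R * k ^+ 2 <= G (Y w) ^+ 2]); last first.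
  by apply/seteqP; split => w /=; rewrite sqE.
move/le_trans; apply; rewrite lee_fin /D -[2 * _ / _]mulrA ler_pM2l// sqr_sqrtr ?(ltW jp)//.
rewrite [X in - X]mulrC.
by have := expRN_powR_le 1 r2 j0; rewrite divff// powRr1 ?(ltW jp).
Qed.

End LipschitzConcentration.

(** * One layer *)

Section Layer.
Context {R : realType}.
Implicit Types (s : R -> R) (lam : R).

Definition layer p q n s (z : 'M[R]_(p, n)) (w : 'M[R]_(q, p)) : 'M[R]_(q, n) :=
  (Num.sqrt q%:R)^-1 *: map_mx s (w *m z).

Lemma hs_norm_layerB p q n s lam (z z' : 'M[R]_(p, n)) (w w' : 'M[R]_(q, p)) :
  0 <= lam -> (forall x y, `|s x - s y| <= lam * `|x - y|) ->
  hs_norm (layer s z w - layer s z' w') <=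
    lam / Num.sqrt q%:R * hs_norm (w *m z - w' *m z').
Proof.
move=> lam0 sL; rewrite /layer -scalerBr hs_normZ ger0_norm ?invr_ge0 ?sqrtr_ge0//.
by rewrite [lam / _]mulrC -mulrA ler_wpM2l ?invr_ge0 ?sqrtr_ge0// hs_norm_map_mx.
Qed.

Lemma layer_lipschitz_weights p q n s lam K (z : 'M[R]_(p, n)) (w w' : 'M[R]_(q, p)) :
  0 <= lam -> (forall x y, `|s x - s y| <= lam * `|x - y|) ->
  0 <= K -> op_bound z K ->
  hs_norm (layer s z w - layer s z w') <= lam * K / Num.sqrt q%:R * hs_norm (w - w').
Proof.
move=> lam0 sL K0 zK; rewrite (le_trans (hs_norm_layerB _ _ _ _ lam0 sL))//.
have -> : lam * K / Num.sqrt q%:R * hs_norm (w - w') =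
    lam / Num.sqrt q%:R * (K * hs_norm (w - w')) by ring.
by rewrite -mulmxBl ler_wpM2l ?divr_ge0 ?sqrtr_ge0// hs_norm_mulmx_op.
Qed.

Lemma layerN p q n s (z : 'M[R]_(p, n)) (w : 'M[R]_(q, p)) :
  (forall x, s (- x) = - s x) -> layer s z (- w) = - layer s z w.
Proof.
move=> sN; rewrite /layer mulNmx -scalerN; congr (_ *: _).
by apply/matrixP => i j; rewrite !mxE sN.
Qed.

(** A scalar is viewed as a 1 x 1 matrix, which reduces the claim to the matrix case. *)
Lemma lipschitz_measurable d (T : measurableType d) s lam (f : T -> R) :
  (forall x y, `|s x - s y| <= lam * `|x - y|) -> measurable_fun setT f ->
  measurable_fun setT (fun w => s (f w)).
Proof.
move=> sL mf; have lam0 : 0 <= lam.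
  by have := sL 1 0; rewrite subr0 normr1 mulr1; apply: le_trans.
have GL : hs_lipschitz lam (fun A : 'M[R]_1 => s (A 0 0)).
  move=> A B; rewrite (le_trans (sL _ _))// ler_wpM2l//.
  by rewrite hs_norm11 !mxE.
have := @measurable_hs_lipschitz R _ T 1 1 lam _ (fun w => (f w)%:M) GL.
rewrite (_ : _ \o _ = fun w => s (f w)); last first.
  by apply/funext => w; rewrite /= mxE eqxx mulr1n.
apply=> i j; rewrite (_ : (fun w => _) = fun w => f w)//.
by apply/funext => w; rewrite !ord1 mxE eqxx mulr1n.
Qed.

Lemma random_mx_layer d (T : measurableType d) p q n s lam
    (Z : T -> 'M[R]_(p, n)) (W : T -> 'M[R]_(q, p)) :
  (forall x y, `|s x - s y| <= lam * `|x - y|) ->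
  random_mx Z -> random_mx W -> random_mx (fun w => layer s (Z w) (W w)).
Proof.
move=> sL mZ mW i j.
rewrite (_ : (fun w => _) = fun w => (Num.sqrt q%:R)^-1 * s (\sum_k W w i k * Z w k j)).
  apply: measurable_funM => //; apply: (lipschitz_measurable sL).
  by apply: measurable_sum => k; exact: measurable_funM.
by apply/funext => w; rewrite /layer !mxE.
Qed.

Lemma layer_comp_lipschitz p q n s lam k K (z : 'M[R]_(p, n)) (F : 'M[R]_(q, n) -> R) :
  0 <= lam -> (forall x y, `|s x - s y| <= lam * `|x - y|) ->
  0 <= K -> op_bound z K -> 0 <= k -> hs_lipschitz k F ->
  hs_lipschitz (k * (lam * K / Num.sqrt q%:R)) (fun w => F (layer s z w)).
Proof.
move=> lam0 sL K0 zK k0 Fk w w'; rewrite (le_trans (Fk _ _))// -[leRHS]mulrA.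
apply: ler_wpM2l => //; exact: layer_lipschitz_weights.
Qed.

Lemma bilin_lipschitz p q (u : 'rV[R]_p) (v : 'rV[R]_q) :
  hs_norm u <= 1 -> hs_norm v <= 1 -> hs_lipschitz 1 (fun A => bilin u A v).
Proof.
move=> u1 v1 A B; rewrite bilinB (le_trans (bilin_le _ _ _))// mulrAC.
by rewrite ler_wpM2r ?hs_norm_ge0// mulr_ile1 ?hs_norm_ge0.
Qed.

Lemma layer_integrable (rho : R) d (T : measurableType d) (P : probability T R)
    p q n s lam (W : T -> 'M[R]_(q, p)) (z : 'M[R]_(p, n)) (F : 'M[R]_(q, n) -> R) :
  0 < rho -> random_mx W -> subgaussian_conc P rho W ->
  0 <= lam -> (forall x y, `|s x - s y| <= lam * `|x - y|) -> hs_lipschitz 1 F ->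
  P.-integrable setT (fun w => (F (layer s z (W w)))%:E).
Proof.
move=> rho0 mW sub lam0 sL F1; have [c _ H] := subgaussian_mean_tail rho0.
have G := layer_comp_lipschitz lam0 sL (hs_norm_ge0 z) (op_bound_hs_norm z) ler01 F1.
set k := (k in hs_lipschitz k _) in G.
have k0 : 0 <= k by rewrite /k mul1r divr_ge0 ?sqrtr_ge0// mulr_ge0 ?hs_norm_ge0.
(* The constant [k] vanishes when [z = 0], while the tail lemma wants a positive one; any larger
   constant serves for integrability. *)
have k1 : 0 < k + 1 by lra.
have G1 : hs_lipschitz (k + 1) (fun w => F (layer s z w)).
  by move=> A B; rewrite (le_trans (G A B))// ler_wpM2r ?hs_norm_ge0// lerDl.
by have [] := H _ _ P _ _ W _ _ mW sub k1 G1.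
Qed.

(* Each entry of W A is an odd linear function of W, so E|W A|^2 is at most a
   constant times q |A|^2; this controls the mean where the operator norm of W,
   which may be large when p >> q, would not. *)
Lemma layer_mean_lipschitz (rho lam : R) : 0 < rho -> 0 < lam ->
  exists2 k : R, 0 < k &
  forall d (T : measurableType d) (P : probability T R) p q n s
    (W : T -> 'M[R]_(q, p)) (F : 'M[R]_(q, n) -> R),
  (0 < q)%N -> random_mx W -> symmetric_law P W -> subgaussian_conc P rho W ->
  (forall x y, `|s x - s y| <= lam * `|x - y|) -> hs_lipschitz 1 F ->
  hs_lipschitz k (fun z => \int[P]_w F (layer s z (W w))).
Proof.
move=> rho0 lam0; have [M M0 HM] := subgaussian_second_moment rho0.
exists (lam * (M + 1) / 2); first by rewrite divr_gt0// mulr_gt0// addr_gt0.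
move=> d T P p q n s W F q0 mW symW sub sL F1 z z'.
have int z0 := layer_integrable z0 rho0 mW sub (ltW lam0) sL F1.
set A := z - z'; set a := hs_norm A.
have [a0|an0] := eqVneq a 0.
  have -> : z = z' by apply/eqP; rewrite -subr_eq0; apply/eqP/hs_norm_eq0.
  by rewrite subrr normr0 mulr_ge0 ?hs_norm_ge0// divr_ge0// mulr_ge0 ?addr_ge0 ?ltW.
have a0 : 0 < a by rewrite lt_neqAle eq_sym an0 hs_norm_ge0.
have qR : 0 < q%:R :> R by rewrite ltr0n.
have sq : 0 < Num.sqrt (q%:R : R) by rewrite sqrtr_gt0.
rewrite -RintegralB//; [|exact: int z|exact: int z'].
have intB := integrableB measurableT (int z) (int z').
rewrite -lee_fin EFin_normr_Rintegral//.
apply: le_trans (le_abse_integral _ _ (measurable_int _ intB)) _ => //.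
(* Weights of the inequality [lam h / sqrt q <= c1 h^2 + c2], with equality at [h = sqrt q a], the
   expected size of [|W A|]. It replaces Jensen's inequality: only the second moment of [h] remains
   to be bounded. *)
pose c1 := lam / (2 * q%:R * a); pose c2 := lam * a / 2.
have c10 : 0 <= c1 by rewrite divr_ge0 ?(ltW lam0)// !mulr_ge0 ?(ltW a0).
have c20 : 0 <= c2 by rewrite divr_ge0 ?mulr_ge0 ?(ltW lam0) ?(ltW a0).
(* An entry sees only row [i] of [w], so its constant is the norm of one column of [A]; summing the
   squares over [i] and [j] yields [q a^2]. *)
have ent i j : hs_lipschitz (hs_norm (col j A)) (fun w : 'M[R]_(q, p) => (w *m A) i j).
  move=> w w'; have -> : (w *m A) i j - (w' *m A) i j = (row i (w - w') *m col j A) 0 0.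
    have -> : (w *m A) i j - (w' *m A) i j = ((w - w') *m A) i j by rewrite mulmxBl !mxE.
    by rewrite mxE [RHS]mxE; apply: eq_bigr => l _; rewrite !mxE.
  rewrite -hs_norm11 (le_trans (hs_norm_mulmx _ _))// mulrC ler_wpM2l ?hs_norm_ge0//.
  rewrite -ler_sqr ?nnegrE ?hs_norm_ge0// [leRHS]hs_norm_row_sum (bigD1 i)//= lerDl.
  by rewrite sumr_ge0// => l _; exact: sqr_ge0.
have ment i j : measurable_fun setT (fun w => (W w *m A) i j ^+ 2).
  apply: measurable_funX; exact: (measurable_hs_lipschitz (ent i j) mW).
have mhs : measurable_fun setT (fun w => hs_norm (W w *m A) ^+ 2).
  under eq_fun do rewrite hs_norm_sqr.
  by apply: measurable_sum => i; apply: measurable_sum => j.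
apply: (@le_trans _ _ (\int[P]_w (c1 * hs_norm (W w *m A) ^+ 2 + c2)%:E)%E).
  apply: ge0_le_integral => //.
  - by apply: measurableT_comp => //; exact: measurable_int intB.
  - apply/measurable_EFinP; apply: measurable_funD => //; exact: measurable_funM.
  move=> w _; rewrite -EFinB lee_fin; set h := hs_norm _.
  apply: le_trans (F1 _ _) _; rewrite mul1r.
  apply: le_trans (hs_norm_layerB _ _ _ _ (ltW lam0) sL) _.
  rewrite -mulmxBr -/A -/h -subr_ge0.
  have -> : c1 * h ^+ 2 + c2 - lam / Num.sqrt q%:R * h =
      lam / (2 * q%:R * a) * (h - Num.sqrt q%:R * a) ^+ 2.
    rewrite /c1 /c2; set r := Num.sqrt _ in sq *.
    have -> : q%:R = r ^+ 2 by rewrite sqr_sqrtr// ltW.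
    by field; rewrite !gt_eqF.
  by rewrite mulr_ge0 ?sqr_ge0.
under eq_integral do rewrite EFinD.
rewrite ge0_integralD//; last 2 first.
- by move=> w _; rewrite lee_fin mulr_ge0 ?sqr_ge0.
- by apply/measurable_EFinP; exact: measurable_funM.
under eq_integral do rewrite EFinM.
rewrite integral_cst// [X in (_ * X)%E](_ : _ = 1%E); last exact: probability_setT.
rewrite mule1 ge0_integralZl_EFin//; last 2 first.
- by move=> w _; rewrite lee_fin sqr_ge0.
- exact/measurable_EFinP.
have hs2 : (\int[P]_w (hs_norm (W w *m A) ^+ 2)%:E <= (q%:R * (M * a ^+ 2))%:E)%E.
  under eq_integral do rewrite hs_norm_sqr -sumEFin.
  rewrite ge0_integral_sum//; last 2 first.
  - by move=> i; apply/measurable_EFinP; apply: measurable_sum => j.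
  - by move=> i w _; rewrite lee_fin sumr_ge0// => j _; exact: sqr_ge0.
  rewrite (_ : q%:R * _ = \sum_(i < q) M * a ^+ 2); last first.
    by rewrite sumr_const card_ord mulr_natl.
  rewrite -sumEFin; apply: lee_sum => i _.
  under eq_integral do rewrite -sumEFin.
  rewrite ge0_integral_sum//; last 2 first.
  - by move=> j; apply/measurable_EFinP.
  - by move=> j w _; rewrite lee_fin sqr_ge0.
  rewrite /a hs_norm_col_sum mulr_sumr -sumEFin; apply: lee_sum => j _.
  rewrite mulrC; apply: (HM _ _ P _ _ W (fun w => (w *m A) i j)) => //.
    exact: hs_norm_ge0.
  by move=> w; rewrite mulNmx mxE.
apply: le_trans (leeD (lee_wpmul2l _ hs2) (lexx _)) _; first by rewrite lee_fin.
rewrite -EFinM -EFinD lee_fin le_eqVlt; apply/orP; left; apply/eqP.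
by rewrite /c1 /c2 -/a; field; rewrite !gt_eqF.
Qed.

End Layer.

(** * The network *)

Section NetUnionBound.
Context {R : realType}.

Lemma pow2_le_expR (k : nat) : (2 ^ k)%:R <= expR k%:R :> R.
Proof.
rewrite natrX -[k%:R]mulr1 expRM_natl lerXn2r ?nnegrE ?expR_ge0//.
by have := expR_ge1Dx (1 : R); lra.
Qed.

Lemma measurable_net_bounded d (T : measurableType d) p q (K : R) (Y : T -> 'M[R]_(p, q)) :
  random_mx Y -> measurable [set w | net_bounded K (Y w)].
Proof.
move=> mY.
have mall (I : eqType) (S : seq I) (B : I -> set T) :
    (forall i, i \in S -> measurable (B i)) ->
    measurable [set w | forall i, i \in S -> B i w].
  elim: S => [|i S IH] mB.
    by rewrite (_ : [set w | _] = setT)//; apply/seteqP; split.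
  rewrite (_ : [set w | _] = B i `&` [set w | forall i, i \in S -> B i w]).
    apply: measurableI; first by apply: mB; rewrite mem_head.
    by apply: IH => j jS; apply: mB; rewrite inE jS orbT.
  apply/seteqP; split => [w H|w [Bi H] j]; last by rewrite inE => /predU1P[-> //|/H].
  by split=> [|j jS]; apply: H; rewrite ?mem_head// inE jS orbT.
rewrite (_ : [set w | _] = [set w | forall u, u \in net R p ->
    [set w | forall v, v \in net R q -> `|bilin u (Y w) v| <= K] w]).
  apply: (mall 'rV[R]_p) => u uS; apply: (mall 'rV[R]_q) => v vS.
  apply: measurable_set_le => //; apply: measurableT_comp => //.
  exact: (measurable_hs_lipschitz (bilin_lipschitz (net_hs_norm uS) (net_hs_norm vS))).
by apply/seteqP; split => w H u; [move=> uS v vS|move=> v uS vS]; exact: H.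
Qed.

(** There are at most [2 ^ (18 (p + q)) <= exp (18 (p + q))] pairs. As [r >= 1], the constant 19
    pays for them and leaves [exp (- r^2 (p + q))]. *)
Lemma net_union_bound d (T : measurableType d) (P : probability T R) p q
    (Y : T -> 'M[R]_(p, q)) (K r : R) :
  random_mx Y -> 1 <= r ->
  (forall u v, hs_norm u <= 1 -> hs_norm v <= 1 ->
    (P [set w | (K <= `|bilin u (Y w) v|)%R]
      <= (2 * expR (- (19 * r ^+ 2 * (p + q)%:R)))%:E)%E) ->
  (P [set w | ~ net_bounded K (Y w)] <= (2 * expR (- (r ^+ 2 * (p + q)%:R)))%:E)%E.
Proof.
move=> mY r1 PK.
(* Empty off the nets, so that every [B uv] is measurable; on the nets the unit bound makes the form
   1-Lipschitz. *)
pose B (uv : 'rV[R]_p * 'rV[R]_q) : set T := if (uv.1 \in net R p) && (uv.2 \in net R q)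
  then [set w | K <= `|bilin uv.1 (Y w) uv.2|] else set0.
set b := 2 * expR (- (19 * r ^+ 2 * (p + q)%:R)).
have mB uv : measurable (B uv).
  rewrite /B; case: ifPn => // /andP[uS vS]; apply: measurable_set_le => //.
  apply: measurableT_comp => //.
  exact: (measurable_hs_lipschitz (bilin_lipschitz (net_hs_norm uS) (net_hs_norm vS))).
have := @prob_le_cover_seq _ _ _ P _ [seq (u, v) | u <- net R p, v <- net R q]
  [set w | ~ net_bounded K (Y w)] B b.
move=> /(_ (measurableC (measurable_net_bounded K mY)) mB) H.
apply: le_trans (H _ _) _.
- move=> w /= nb; apply: contrapT => nex; apply: nb => u v uS vS.
  rewrite leNgt; apply/negP => Kuv; apply: nex; exists (u, v).
    by apply/allpairsP; exists (u, v).
  by rewrite /B/= uS vS/= ltW.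
- move=> _ /allpairsP[[u v] [/= uS vS ->]]; rewrite /B/= uS vS.
  by apply: PK; exact: net_hs_norm.
rewrite lee_fin size_allpairs.
have szle : (size (net R p) * size (net R q))%:R <= expR (18 * (p + q)%:R) :> R.
  rewrite -[18]/(18%:R) -natrM; apply: le_trans (pow2_le_expR _).
  by rewrite ler_nat mulnDr expnD leq_mul// size_net.
rewrite (le_trans (ler_wpM2r _ szle)) /b ?mulr_ge0 ?expR_ge0//.
rewrite mulrCA -expRD ler_pM2l// ler_expR.
have := ler0n R (p + q); set x := (p + q)%:R => x0.
suff : x <= r ^+ 2 * x by lra.
by rewrite ler_peMl// exprn_ege1.
Qed.

End NetUnionBound.

Section Model.
Context {R : realType}.

Record network_model (L : nat) (rho lam alpha : R) (d : measure_display)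
    (T : measurableType d) (P : probability T R) (n : nat) (N : nat -> nat)
    (X : T -> 'M[R]_(N 0%N, n)) (W : forall l : nat, T -> 'M[R]_(N l.+1, N l))
    (sigma : nat -> R -> R) : Prop := NetworkModel {
  model_n_gt0 : (0 < n)%N;
  model_N_gt0 : forall l, (l <= L)%N -> (0 < N l)%N;
  model_X_random : random_mx X;
  model_W_random : forall l, (l < L)%N -> random_mx (W l);
  model_indep : forall (SX : set 'M[R]_(N 0%N, n)) (S : forall l, set 'M[R]_(N l.+1, N l)),
    mx_borel SX -> (forall l, (l < L)%N -> mx_borel (S l)) ->
    P (X @^-1` SX `&` \bigcap_(l in [set l | (l < L)%N]) (W l @^-1` S l))
    = (P (X @^-1` SX) * \prod_(l < L) P (W l @^-1` S l))%E;
  model_X_conc : subgaussian_conc P rho X;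
  model_W_conc : forall l, (l < L)%N -> subgaussian_conc P rho (W l);
  model_X_centered : forall i j, ('E_P[fun w => X w i j] = 0)%E;
  model_W_symmetric : forall l, (l < L)%N -> symmetric_law P (W l);
  model_lipschitz : forall l, (l < L)%N -> forall x y,
    `|sigma l x - sigma l y| <= lam * `|x - y|;
  model_odd : forall l, (l < L)%N -> forall x, sigma l (- x) = - sigma l x;
  model_width : forall l, (1 <= l <= L)%N -> n%:R / (N l)%:R <= alpha }.

(** * Independence of the past layers and the next weight matrix *)

Section Filtration.
Context {L : nat} {rho lam alpha : R} {d : measure_display} {T : measurableType d}
  {P : probability T R} {n : nat} {N : nat -> nat} {X : T -> 'M[R]_(N 0%N, n)}
  {W : forall l : nat, T -> 'M[R]_(N l.+1, N l)} {sigma : nat -> R -> R}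
  (M : network_model L rho lam alpha P X W sigma).

(** The pi-system generating the sigma-algebra of [X, W_0, ..., W_{l-1}], with respect to which
    [Z_l] is measurable. *)
Definition past_cylinders l : set (set T) := [set A | exists SX S,
  [/\ mx_borel SX, (forall j, mx_borel (S j)) &
      A = X @^-1` SX `&` \bigcap_(j in [set j | (j < l)%N]) (W j @^-1` S j)]].

Definition layer_events l : set (set T) := [set B | exists2 S, mx_borel S & B = W l @^-1` S].

Lemma mx_borelT p q : mx_borel [set: 'M[R]_(p, q)].
Proof. exact: (@measurableT _ (g_sigma_algebraType _)). Qed.

Lemma mx_borelI p q (A B : set 'M[R]_(p, q)) : mx_borel A -> mx_borel B -> mx_borel (A `&` B).
Proof. by move=> mA mB; apply: (@measurableI _ (g_sigma_algebraType _)). Qed.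

Lemma mx_borel_entry p q (i : 'I_p) (j : 'I_q) (B : set R) : measurable B ->
  mx_borel [set A : 'M[R]_(p, q) | B (A i j)].
Proof. by move=> mB; apply: sub_sigma_algebra; exists i, j, B. Qed.

Lemma measurable_past_cylinders l : (l <= L)%N -> past_cylinders l `<=` measurable.
Proof.
move=> lL _ [SX [S [mSX mS ->]]]; apply: measurableI.
  exact: random_mx_preimage (model_X_random M) _ mSX.
apply: fin_bigcap_measurable => [|j /= jl]; first exact: finite_II.
apply: random_mx_preimage (mS j).
exact: (model_W_random M (leq_trans jl lL)).
Qed.

Lemma measurable_layer_events l : (l < L)%N -> layer_events l `<=` measurable.
Proof. by move=> lL _ [S mS ->]; apply: random_mx_preimage mS; exact: (model_W_random M). Qed.

Lemma setI_past_cylinders l : setI_closed (past_cylinders l).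
Proof.
move=> _ _ [SX [S [mSX mS ->]]] [SX' [S' [mSX' mS' ->]]].
exists (SX `&` SX'), (fun j => S j `&` S' j); split => [|j|].
- exact: mx_borelI.
- exact: mx_borelI.
rewrite setIACA preimage_setI; congr (_ `&` _); rewrite -bigcapI.
by apply: eq_bigcapr => j _; rewrite preimage_setI.
Qed.

Lemma setI_layer_events l : setI_closed (layer_events l).
Proof.
move=> _ _ [S mS ->] [S' mS' ->]; exists (S `&` S'); first exact: mx_borelI.
by rewrite preimage_setI.
Qed.

(* A set of matrices attached to one layer, extended by [setT] to a family
   indexed by all layers. *)
Definition only_layer l (S : set 'M[R]_(N l.+1, N l)) : forall j, set 'M[R]_(N j.+1, N j) :=
  fun j => if @eqP _ l j is ReflectT e then
    eq_rect l (fun j => set 'M[R]_(N j.+1, N j)) S j e else setT.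
Arguments only_layer : clear implicits.

Lemma only_layerE l S : only_layer l S l = S.
Proof. by rewrite /only_layer; case: eqP => // e; rewrite (eq_irrelevance e erefl). Qed.

Lemma only_layer_neq l S j : l != j -> only_layer l S j = setT.
Proof. by rewrite /only_layer; case: eqP. Qed.

Lemma mx_borel_only_layer l S j : mx_borel S -> mx_borel (only_layer l S j).
Proof.
move=> mS; have [<-|lj] := eqVneq l j; first by rewrite only_layerE.
by rewrite only_layer_neq//; exact: mx_borelT.
Qed.

Lemma indep_past_layer l : (l < L)%N -> forall A B,
  <<s past_cylinders l >> A -> <<s layer_events l >> B -> P (A `&` B) = (P A * P B)%E.
Proof.
move=> lL; have lL' := ltnW lL.
apply: indep_sigma_algebra.
- exact: measurable_past_cylinders.
- exact: measurable_layer_events.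
- exact: setI_past_cylinders.
- exact: setI_layer_events.
move=> _ _ [SX [S [mSX mS ->]]] [S0 mS0 ->].
(* Both events are written as full families over [j < L], padded by [setT]. The families [S1] and
   [S2] differ only at [j = l], so the two products agree in every other factor. *)
pose S1 j := if (j < l)%N then S j else setT.
pose S2 j := if (j < l)%N then S j else only_layer l S0 j.
have mS1 j : mx_borel (S1 j) by rewrite /S1; case: ifP => // _; exact: mx_borelT.
have mS2 j : mx_borel (S2 j) by rewrite /S2; case: ifP => // _; exact: mx_borel_only_layer.
have E1 : X @^-1` SX `&` \bigcap_(j in [set j | (j < l)%N]) (W j @^-1` S j) =
    X @^-1` SX `&` \bigcap_(j in [set j | (j < L)%N]) (W j @^-1` S1 j).
  congr (_ `&` _); apply/seteqP; split => w H j /= jl.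
    by rewrite /S1; case: ifPn => // jl'; exact: H.
  by have := H j (ltn_trans jl lL); rewrite /S1 jl.
have E2 : X @^-1` SX `&` \bigcap_(j in [set j | (j < l)%N]) (W j @^-1` S j) `&` W l @^-1` S0 =
    X @^-1` SX `&` \bigcap_(j in [set j | (j < L)%N]) (W j @^-1` S2 j).
  rewrite -setIA; congr (_ `&` _); apply/seteqP; split => [w [H Hl] j /= jL|w H].
    rewrite /S2; case: ifPn => [|jl]; first exact: H.
    have [e|lj] := eqVneq l j; last by rewrite only_layer_neq.
    by case: _ / e; rewrite only_layerE.
  split=> [j /= jl|]; first by have := H j (ltn_trans jl lL); rewrite /S2 jl.
  by have := H l lL; rewrite /S2 ltnn only_layerE.
rewrite E2 E1 !(model_indep M)// -muleA; congr (_ * _)%E.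
rewrite (bigD1 (Ordinal lL))//= [in RHS](bigD1 (Ordinal lL))//=.
rewrite {1}/S2 {1}/S1 ltnn only_layerE preimage_setT probability_setT mul1e muleC.
congr (_ * _)%E; apply: eq_bigr => j jl; rewrite /S1 /S2; case: ifPn => // _.
by rewrite only_layer_neq// eq_sym; apply: contra jl => /eqP jl; exact/eqP/val_inj.
Qed.

Lemma random_mx_past_X l : random_mx (X : g_sigma_algebraType (past_cylinders l) -> _).
Proof.
move=> i j _ B mB; rewrite setTI; apply: sub_sigma_algebra.
exists [set A | B (A i j)], (fun j => setT); split.
- exact: mx_borel_entry.
- by move=> ?; exact: mx_borelT.
by rewrite [X in _ `&` X](_ : _ = setT) ?setIT//; apply/seteqP; split.
Qed.

Lemma random_mx_past_W l k : (k < l)%N ->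
  random_mx (W k : g_sigma_algebraType (past_cylinders l) -> _).
Proof.
move=> kl i j _ B mB; rewrite setTI; apply: sub_sigma_algebra.
exists setT, (only_layer k [set A | B (A i j)]); split.
- exact: mx_borelT.
- by move=> ?; apply: mx_borel_only_layer; exact: mx_borel_entry.
rewrite preimage_setT setTI; apply/seteqP; split => [w Bw h /= hl|w /(_ k kl)].
  have [e|kh] := eqVneq k h; last by rewrite only_layer_neq.
  by case: _ / e; rewrite only_layerE.
by rewrite only_layerE.
Qed.

Lemma random_mx_layer_W l : random_mx (W l : g_sigma_algebraType (layer_events l) -> _).
Proof.
move=> i j _ B mB; rewrite setTI; apply: sub_sigma_algebra.
by exists [set A | B (A i j)] => //; exact: mx_borel_entry.
Qed.

Let Z k w := netZ (X w) (fun l => W l w) sigma k.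

Lemma netZS k w : Z k.+1 w = layer (sigma k) (Z k w) (W k w).
Proof. by []. Qed.

(** Measurability for the past alone, and not only for the ambient sigma-algebra, is what allows
    [Z_l] and [W_l] to be read on separate copies of the sample space. *)
Lemma random_mx_past_Z l k : (l <= L)%N -> (k <= l)%N ->
  random_mx (Z k : g_sigma_algebraType (past_cylinders l) -> _).
Proof.
move=> lL; elim: k => [_ i j|k IH kl].
  rewrite (_ : (fun w => _) = fun w => (Num.sqrt (N 0%N)%:R)^-1 * X w i j).
    by apply: measurable_funM => //; exact: random_mx_past_X.
  by apply/funext => w; rewrite /Z /= mxE.
apply: (random_mx_layer (model_lipschitz M (leq_trans kl lL))).
  exact: IH (ltnW kl).
exact: random_mx_past_W.
Qed.

Lemma random_mx_Z k : (k <= L)%N -> random_mx (Z k).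
Proof.
move=> kL i j _ B mB.
have sub := sigma_algebra_sub_measurable (measurable_past_cylinders kL).
by apply: sub; apply: (random_mx_past_Z kL (leqnn k)).
Qed.

(* Conditionally on the past, [W l] keeps its law, so an event about the layer
   [l.+1] can be estimated for a fixed value of [Z l]. *)
Lemma prob_next_layer_le l (Q : set ('M[R]_(N l, n) * 'M[R]_(N l.+1, N l))) (b : R) :
  (l < L)%N ->
  (forall d' (T' : measurableType d') (z : T' -> 'M[R]_(N l, n)) (y : T' -> 'M[R]_(N l.+1, N l)),
     random_mx z -> random_mx y -> measurable [set w | Q (z w, y w)]) ->
  (forall z, (P [set w | Q (z, W l w)] <= b%:E)%E) ->
  (P [set w | Q (Z l w, W l w)] <= b%:E)%E.
Proof.
move=> lL mQ Qb.
pose T1 := g_sigma_algebraType (past_cylinders l).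
pose T2 := g_sigma_algebraType (layer_events l).
have := @prob_diagonal_le R _ T P _ _ b (measurable_past_cylinders (ltnW lL))
  (measurable_layer_events lL) (indep_past_layer lL)
  [set ww : T1 * T2 | Q (Z l ww.1, W l ww.2)].
(* A section freezes [Z l w] and leaves [W l] random. Measurability of [Q] is then needed on the
   product space, hence its formulation along arbitrary random matrices. *)
apply=> [|w]; last exact: (Qb (Z l w)).
have mZ : random_mx (fun ww : T1 * T2 => Z l ww.1).
  move=> i j; apply: (@measurableT_comp _ _ _ _ _ _ (fun w : T1 => Z l w i j)).
    exact: (random_mx_past_Z (ltnW lL) (leqnn l)).
  exact: measurable_fst.
have mW : random_mx (fun ww : T1 * T2 => W l ww.2).
  move=> i j; apply: (@measurableT_comp _ _ _ _ _ _ (fun w : T2 => W l w i j)).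
    exact: random_mx_layer_W.
  exact: measurable_snd.
exact: (mQ _ _ _ _ mZ mW).
Qed.

End Filtration.
End Model.

Section ZeroMean.
Context {R : realType} {d : measure_display} {T : measurableType d} (P : probability T R).

(** Integrability travels with the vanishing mean, so that both pass to linear combinations of the
    entries of [X]. *)
Definition zero_mean (f : T -> R) : Prop :=
  P.-integrable setT (EFin \o f) /\ \int[P]_w f w = 0.

Lemma zero_meanD f g : zero_mean f -> zero_mean g -> zero_mean (fun w => f w + g w).
Proof.
move=> [fi f0] [gi g0]; split; last by rewrite RintegralD// f0 g0 addr0.
by have := integrableD measurableT fi gi; apply: eq_integrable => // w _ /=.
Qed.

Lemma zero_meanZ a f : zero_mean f -> zero_mean (fun w => a * f w).
Proof.
move=> [fi f0]; split; last by rewrite RintegralZl// f0 mulr0.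
by have := integrableZl measurableT a fi; apply: eq_integrable => // w _ /=.
Qed.

Lemma zero_mean_sum (I : Type) (s : seq I) (f : I -> T -> R) :
  (forall i, zero_mean (f i)) -> zero_mean (fun w => \sum_(i <- s) f i w).
Proof.
move=> f0; elim: s => [|i s IH].
  rewrite (_ : (fun w => _) = cst 0); last by apply/funext => w; rewrite big_nil.
  by split; [exact: finite_measure_integrable_cst|rewrite Rintegral_cst// mul0r].
rewrite (_ : (fun w => _) = fun w => f i w + \sum_(j <- s) f j w).
  exact: zero_meanD.
by apply/funext => w; rewrite big_cons.
Qed.

End ZeroMean.

(** * Norms of the layers *)

Section Network.
Context {R : realType}.

Definition random_netZ d (T : measurableType d) n (N : nat -> nat) (X : T -> 'M[R]_(N 0%N, n))
  (W : forall l : nat, T -> 'M[R]_(N l.+1, N l)) (sigma : nat -> R -> R) k (w : T) : 'M[R]_(N k, n) :=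
  netZ (X w) (fun l => W l w) sigma k.

(** Equal to [1 + n / n_0], the order of the squared operator norm of [Z_0]. *)
Definition aspect (n n0 : nat) : R := (n0 + n)%:R / n0%:R.

Lemma aspect_gt0 n n0 : (0 < n0)%N -> 0 < aspect n n0.
Proof. by move=> n00; rewrite divr_gt0// ltr0n// addn_gt0 n00. Qed.

(** Since [q >= n / alpha], the quotient is at least [n n_0 / (alpha (n_0 + n))], and the minimum
    [m] satisfies [m (n_0 + n) <= 2 n n_0]. *)
Lemma width_ratio (alpha : R) (n n0 q : nat) : 0 < alpha -> (0 < n0)%N -> (0 < q)%N ->
  n%:R / q%:R <= alpha -> (minn n n0)%:R / (2 * alpha) <= q%:R / aspect n n0.
Proof.
move=> a0 n00 q0; have n0R : 0 < n0%:R :> R by rewrite ltr0n.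
rewrite ler_pdivrMr ?ltr0n// => nq.
have nn0 : 0 < (n0 + n)%:R :> R by rewrite ltr0n addn_gt0 n00.
rewrite /aspect invf_div mulrA ler_pdivrMr ?mulr_gt0// mulrAC ler_pdivlMr//.
have m1 : (minn n n0)%:R <= n%:R :> R by rewrite ler_nat geq_minl.
have m2 : (minn n n0)%:R <= n0%:R :> R by rewrite ler_nat geq_minr.
have h1 : (minn n n0)%:R * n0%:R <= n%:R * n0%:R :> R by rewrite ler_wpM2r.
have h2 : (minn n n0)%:R * n%:R <= n0%:R * n%:R :> R by rewrite ler_wpM2r.
have h3 : n%:R * n0%:R <= alpha * q%:R * n0%:R by rewrite ler_wpM2r.
rewrite natrD; lra.
Qed.

Lemma subgaussian_centered_bilin (rho : R) : 0 < rho -> exists2 c : R, 0 < c &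
  forall d (T : measurableType d) (P : probability T R) p q (Y : T -> 'M[R]_(p, q)) u v t,
  random_mx Y -> subgaussian_conc P rho Y ->
  (forall i j, ('E_P[fun w => Y w i j] = 0)%E) ->
  hs_norm u <= 1 -> hs_norm v <= 1 -> 0 < t ->
  (P [set w | (t <= `|bilin u (Y w) v|)%R] <= (2 * expR (- (c * t ^+ 2)))%:E)%E.
Proof.
move=> rho0; have [c c0 H] := subgaussian_mean_tail rho0.
exists c => // d T P p q Y u v t mY sub EY u1 v1 t0.
have [_ tail] := H _ _ P _ _ Y _ 1 mY sub ltr01 (bilin_lipschitz u1 v1).
suff [_ b0] : zero_mean P (fun w => bilin u (Y w) v).
  by have := tail _ t0; rewrite b0 mul1r; under eq_set do rewrite subr0.
rewrite (_ : (fun w => _) = fun w => \sum_j \sum_i (u 0 i * v 0 j) * Y w i j); last first.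
  by apply/funext => w; rewrite bilinE; apply: eq_bigr => j _; apply: eq_bigr => i _; ring.
apply: zero_mean_sum => j; apply: zero_mean_sum => i; apply: zero_meanZ; split.
  have ent : hs_lipschitz 1 (fun A : 'M[R]_(p, q) => A i j).
    by move=> A B; rewrite mul1r; have := hs_norm_entry (A - B) i j; rewrite !mxE.
  by have [] := H _ _ P _ _ Y _ 1 mY sub ltr01 ent.
by have := EY i j; rewrite unlock /Rintegral => ->.
Qed.

(** Each layer multiplies the bound by a constant times [r] and adds one failure event of
    probability [2 exp (- m r^2)], whence the prefactor [2 (k + 1)]. *)
Lemma netZ_net_bounded (rho lam alpha : R) : 0 < rho -> 0 < lam -> 0 < alpha ->
  exists2 A : nat -> R, (forall k, 0 < A k) &
  forall L d (T : measurableType d) (P : probability T R) n (N : nat -> nat)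
    (X : T -> 'M[R]_(N 0%N, n)) (W : forall l : nat, T -> 'M[R]_(N l.+1, N l)) sigma k r,
  network_model L rho lam alpha P X W sigma -> (k <= L)%N -> 1 <= r ->
  (P [set w | ~ net_bounded (A k * r ^+ k.+1 * Num.sqrt (aspect n (N 0%N)))
       (random_netZ X W sigma k w)]
   <= ((2 * k.+1)%:R * expR (- ((minn n (N 0%N))%:R * r ^+ 2)))%:E)%E.
Proof.
move=> rho0 lam0 alpha0.
have [c c0 HX] := subgaussian_centered_bilin rho0.
(* With [t = a0 r sqrt (n_0 + n)] the exponent [c t^2] is exactly what the union bound over the nets
   requires. *)
have [a0 a00 a0E] : exists2 a0 : R, 0 < a0 & a0 ^+ 2 = 19 / c.
  by exists (Num.sqrt (19 / c)); rewrite ?sqrtr_gt0 ?sqr_sqrtr ?divr_ge0 ?divr_gt0// ltW.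
(* The 2 passes from the net to the operator norm, [lam] comes from the activation, [rho sqrt 19]
   from the deviation demanded by the union bound, and [1 + alpha] bounds [(q + n) / q]. *)
pose b := 2 * lam * rho * Num.sqrt (19 * (1 + alpha)).
have b0 : 0 < b by rewrite !mulr_gt0// sqrtr_gt0 mulr_gt0// addr_gt0.
exists (fun k => a0 * b ^+ k) => [k|L d T P n N X W sigma k r M + r1].
  by rewrite mulr_gt0// exprn_gt0.
have r0 : 0 < r by lra.
pose K k := a0 * b ^+ k * r ^+ k.+1 * Num.sqrt (aspect n (N 0%N)).
have N0 : (0 < N 0%N)%N := model_N_gt0 M (leq0n L).
have D0 := @aspect_gt0 n _ N0.
have K0 k' : 0 < K k' by rewrite /K !mulr_gt0 ?sqrtr_gt0 ?exprn_gt0 ?D0.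
have expm q' : (minn n (N 0%N) <= q')%N ->
    2 * expR (- (r ^+ 2 * q'%:R)) <= 2 * expR (- ((minn n (N 0%N))%:R * r ^+ 2)) :> R.
  move=> mq; rewrite ler_pM2l// ler_expR lerN2 mulrC ler_wpM2l ?sqr_ge0//.
  by rewrite ler_nat.
elim: k => [_|k IH kL]; rewrite -/(K _).
  rewrite muln1; apply: (@le_trans _ _ (2 * expR (- (r ^+ 2 * (N 0%N + n)%:R)))%:E); last first.
    by rewrite lee_fin expm// (leq_trans (geq_minl _ _))// leq_addl.
  have mZ := random_mx_Z M (leq0n L).
  apply: net_union_bound mZ r1 _ => u v u1 v1.
  pose t := a0 * r * Num.sqrt (N 0%N + n)%:R.
  have t0 : 0 < t by rewrite !mulr_gt0// sqrtr_gt0 ltr0n addn_gt0 N0.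
  have sN : 0 < Num.sqrt ((N 0%N)%:R : R) by rewrite sqrtr_gt0 ltr0n.
  have KE : K 0%N = (Num.sqrt (N 0%N)%:R)^-1 * t.
    rewrite /K /t /aspect expr0 mulr1 expr1 sqrtrM// sqrtrV//; ring.
  have := HX _ _ P _ _ X u v t (model_X_random M) (model_X_conc M)
    (model_X_centered M) u1 v1 t0.
  rewrite (_ : c * t ^+ 2 = 19 * r ^+ 2 * (N 0%N + n)%:R).
    congr (P _ <= _)%E; apply/seteqP; split => w /=;
      by rewrite KE bilinZm normrM gtr0_norm ?invr_gt0// ler_pM2l ?invr_gt0.
  by rewrite /t !exprMn sqr_sqrtr// a0E; field; rewrite gt_eqF.
have k_le := ltnW kL; have {}IH := IH k_le.
set q := N k.+1; have q0 : (0 < q)%N by exact: (model_N_gt0 M kL).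
have qR : 0 < q%:R :> R by rewrite ltr0n.
have sq : 0 < Num.sqrt (q%:R : R) by rewrite sqrtr_gt0.
have sL := model_lipschitz M kL.
have mZ := random_mx_Z M k_le; have mZ' := random_mx_Z M kL.
have mW := model_W_random M kL.
(* Failure at layer [k + 1] while layer [k] is under control; for a fixed [z] violating the control
   this event is empty. *)
pose Q := [set zy : 'M[R]_(N k, n) * 'M[R]_(q, N k) |
  net_bounded (K k) zy.1 /\ ~ net_bounded (K k.+1) (layer (sigma k) zy.1 zy.2)].
have mQ d' (T' : measurableType d') (z : T' -> 'M[R]_(N k, n)) (y : T' -> 'M[R]_(q, N k)) :
    random_mx z -> random_mx y -> measurable [set w | Q (z w, y w)].
  move=> mz my; apply: measurableI; first exact: measurable_net_bounded.
  apply: measurableC; apply: measurable_net_bounded.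
  exact: random_mx_layer.
rewrite mulnS natrD mulrDl addrC.
apply: (@prob_le_cover2 _ _ _ P _ [set w | ~ net_bounded (K k) (random_netZ X W sigma k w)]
   [set w | Q (random_netZ X W sigma k w, W k w)]).
- by apply: measurableC; exact: measurable_net_bounded.
- by apply: measurableC; exact: measurable_net_bounded.
- exact: mQ.
- move=> w /= nb; have [?|?] := pselect (net_bounded (K k) (random_netZ X W sigma k w)).
    by right.
  by left.
- by move: IH; rewrite mulnC.
apply: (prob_next_layer_le M kL mQ) => z.
have [zK|zK] := pselect (net_bounded (K k) z); last first.
  rewrite (_ : [set w | _] = set0) ?measure0 ?lee_fin ?mulr_ge0 ?expR_ge0//.
  by apply/seteqP; split => // w [].
apply: (@prob_le_mono _ _ _ P _ [set w | ~ net_bounded (K k.+1) (layer (sigma k) z (W k w))]).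
- by apply: mQ => // i j; exact: measurable_cst.
- by apply: measurableC; apply: measurable_net_bounded; apply: random_mx_layer => // i j.
- by move=> w [].
apply: (@le_trans _ _ (2 * expR (- (r ^+ 2 * (q + n)%:R)))%:E); last first.
  by rewrite lee_fin expm// (leq_trans (geq_minl _ _))// leq_addl.
apply: net_union_bound => //; first by apply: random_mx_layer => // i j.
move=> u v u1 v1.
pose kap := 1 * (lam * (2 * K k) / Num.sqrt q%:R).
have kap0 : 0 < kap by rewrite /kap mul1r divr_gt0// mulr_gt0// mulr_gt0.
have K2 : 0 <= 2 * K k by rewrite mulr_ge0// ltW.
have lipG := layer_comp_lipschitz (ltW lam0) sL K2 (net_bounded_op zK) ler01
  (bilin_lipschitz u1 v1) : hs_lipschitz kap (fun w : 'M[R]_(q, N k) => _).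
have oddG (y : 'M[R]_(q, N k)) :
    bilin u (layer (sigma k) z (- y)) v = - bilin u (layer (sigma k) z y) v.
  rewrite layerN; last exact: (model_odd M kL).
  by rewrite -scaleN1r bilinZm mulN1r.
have med := odd_median0 mW (model_W_symmetric M kL) lipG oddG.
pose t := rho * r * Num.sqrt (19 * (q + n)%:R).
have qn0 : 0 < (q + n)%:R :> R by rewrite ltr0n addn_gt0 q0.
have t0 : 0 < t by rewrite !mulr_gt0// sqrtr_gt0 mulr_gt0.
have mG := measurable_hs_lipschitz lipG mW.
have := subgaussian_median_tail (model_W_conc M kL) kap0 lipG med t0.
rewrite (_ : t ^+ 2 / rho ^+ 2 = 19 * r ^+ 2 * (q + n)%:R); last first.
  rewrite /t !exprMn sqr_sqrtr ?mulr_ge0//; by field; rewrite gt_eqF.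
apply: prob_le_mono.
- by apply: measurable_set_le => //; exact: measurableT_comp.
- exact: measurable_dev.
move=> w /=; rewrite subr0; apply: le_trans.
have -> : K k.+1 = b * r * K k by rewrite /K !exprS; ring.
have -> : kap * t = (2 * lam * rho * (Num.sqrt (19 * (q + n)%:R) / Num.sqrt q%:R)) * r * K k.
  by rewrite /kap /t; field; rewrite gt_eqF.
rewrite ler_pM2r// ler_pM2r// /b ler_pM2l ?mulr_gt0//.
rewrite -sqrtrV ?ler0n// -sqrtrM ?mulr_ge0// ler_sqrt ?mulr_ge0 ?addr_ge0 ?(ltW alpha0)//.
rewrite -mulrA ler_pM2l// natrD mulrDl mulfV ?gt_eqF// lerD2l.
exact: (model_width M).
Qed.

End Network.

Section NetworkConcentration.
Context {R : realType}.

(* The mean over the last weight matrix is a Lipschitz function of the previous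
   layer, to which induction applies; the fluctuation around this mean is
   estimated for a fixed previous layer of norm O(r^(k+1) sqrt (aspect n n0)). *)
Lemma netZ_conc (rho lam alpha : R) k : 0 < rho -> 0 < lam -> 0 < alpha ->
  exists C c : R, [/\ 0 <= C, 0 < c &
  forall L d (T : measurableType d) (P : probability T R) n (N : nat -> nat)
    (X : T -> 'M[R]_(N 0%N, n)) (W : forall l : nat, T -> 'M[R]_(N l.+1, N l)) sigma
    (F : 'M[R]_(N k, n) -> R),
  network_model L rho lam alpha P X W sigma -> (k <= L)%N -> hs_lipschitz 1 F ->
  exists a, forall r t, 1 <= r -> 0 < t ->
  (P [set w | (t <= `|F (random_netZ X W sigma k w) - a|)%R]
   <= (C * expR (- (c * ((minn n (N 0%N))%:R *
                   Order.min (r ^+ 2) ((t / r ^+ k) ^+ 2)))))%:E)%E].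
Proof.
move=> rho0 lam0 alpha0.
have [c1 c10 Hmean] := subgaussian_mean_tail rho0.
have [kap kap0 Hkap] := layer_mean_lipschitz rho0 lam0.
have [A A0 Hnet] := netZ_net_bounded rho0 lam0 alpha0.
elim: k => [|k [C [c [C0 c0 IH]]]].
  exists 2, (rho ^+ 2)^-1; split => //; first by rewrite invr_gt0 exprn_gt0.
  move=> L d T P n N X W sigma F M _ F1.
  have n0 : 0 < (N 0%N)%:R :> R by rewrite ltr0n (model_N_gt0 M).
  have s0 : 0 < Num.sqrt ((N 0%N)%:R : R) by rewrite sqrtr_gt0.
  have FL : hs_lipschitz (Num.sqrt (N 0%N)%:R)^-1
      (fun x : 'M[R]_(N 0%N, n) => F ((Num.sqrt (N 0%N)%:R)^-1 *: x)).
    move=> x y; rewrite (le_trans (F1 _ _))// mul1r -scalerBr hs_normZ ger0_norm//.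
  have mX := model_X_random M.
  have [a med] := median_exists P (measurable_hs_lipschitz FL mX).
  exists a => r t r1 t0; have si0 := s0; rewrite -invr_gt0 in si0.
  have := subgaussian_median_tail (model_X_conc M) si0 FL med (mulr_gt0 s0 t0).
  rewrite mulKf ?gt_eqF// => /le_trans; apply.
  rewrite lee_fin ler_pM2l// ler_expR lerN2 [(Num.sqrt _ * t) ^+ 2]exprMn sqr_sqrtr ?ler0n// [leRHS]mulrC.
  rewrite ler_pM2l ?invr_gt0 ?exprn_gt0// ler_pM ?ler0n//.
  - by rewrite le_min !sqr_ge0.
  - by rewrite ler_nat geq_minr.
  - by rewrite expr0 divr1 ge_min lexx orbT.
have kap4 : 0 < 1 + (2 * kap) ^+ 2 by rewrite ltr_wpDr ?sqr_ge0.
(* Here [32 alpha] is 16, from halving [t] and from the factor 2 between net and operator norm,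
   times the [2 alpha] of [width_ratio]. In [c2] the denominator pays for rescaling [t] by
   [2 * kap], and its 1 preserves the branch [r ^ 2]. *)
pose c3 := c1 / (32 * alpha * (lam * A k) ^+ 2).
pose c2 := c / (1 + (2 * kap) ^+ 2).
have c20 : 0 < c2 by rewrite divr_gt0.
have c30 : 0 < c3 by rewrite divr_gt0 ?mulr_gt0 ?exprn_gt0 ?mulr_gt0 ?A0.
(* The three terms account for the conditional mean, the failure of the norm bound and the
   conditional fluctuation. *)
exists (C + ((2 * k.+1)%:R + 2)), (Order.min c2 (Order.min 1 c3)); split.
- by rewrite addr_ge0// addr_ge0.
- by rewrite !lt_min c20 c30 ltr01.
move=> L d T P n N X W sigma F M kL F1.
have k_le := ltnW kL.
set q := N k.+1; have q0 : (0 < q)%N by exact: (model_N_gt0 M kL).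
have qR : 0 < q%:R :> R by rewrite ltr0n.
have sq : 0 < Num.sqrt (q%:R : R) by rewrite sqrtr_gt0.
have sL := model_lipschitz M kL.
have mW := model_W_random M kL; have subW := model_W_conc M kL.
have mZ := random_mx_Z M k_le; have mZ' := random_mx_Z M kL.
have N0 : (0 < N 0%N)%N := model_N_gt0 M (leq0n L).
have D0 := @aspect_gt0 R n _ N0.
have sD : 0 < Num.sqrt (aspect n (N 0%N) : R) by rewrite sqrtr_gt0.
pose F' z := \int[P]_w F (layer (sigma k) z (W k w)).
have F'L : hs_lipschitz kap F'.
  exact: Hkap q0 mW (model_W_symmetric M kL) subW sL F1.
have F'1 : hs_lipschitz 1 (fun z => kap^-1 * F' z).
  have ki : 0 <= kap^-1 by rewrite invr_ge0 ltW.
  by have := hs_lipschitzZ ki F'L; rewrite mulVf ?gt_eqF.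
have [a Ha] := IH _ _ _ _ _ _ _ _ _ _ M k_le F'1.
(* The induction hypothesis was applied to [F'] divided by [kap], so its centre is scaled back. The
   centre precedes [r] and [t], since [r] will later depend on [t]. *)
exists (kap * a) => r t r1 t0; have r0 : 0 < r by lra.
have rk0 j : 0 < r ^+ j by rewrite exprn_gt0.
set m := (minn n (N 0%N))%:R; have m0 : 0 <= m :> R by rewrite ler0n.
set e := m * Order.min _ _; set cc := Order.min c2 _.
have e0 : 0 <= e by rewrite mulr_ge0// le_min !sqr_ge0.
have weaken C' x : 0 <= C' -> cc * e <= x -> C' * expR (- x) <= C' * expR (- (cc * e)).
  by move=> C'0 h; rewrite ler_wpM2l// ler_expR lerN2.
pose K := A k * r ^+ k.+1 * Num.sqrt (aspect n (N 0%N)).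
have K0 : 0 < K by rewrite mulr_gt0// mulr_gt0.
pose Q := [set zy : 'M[R]_(N k, n) * 'M[R]_(q, N k) |
  net_bounded K zy.1 /\ t / 2 <= `|F (layer (sigma k) zy.1 zy.2) - F' zy.1|].
have mQ d' (T' : measurableType d') (z : T' -> 'M[R]_(N k, n)) (y : T' -> 'M[R]_(q, N k)) :
    random_mx z -> random_mx y -> measurable [set w | Q (z w, y w)].
  move=> mz my; apply: measurableI; first exact: measurable_net_bounded.
  apply: measurable_set_le => //; apply: measurableT_comp => //; apply: measurable_funB.
    exact: measurable_hs_lipschitz F1 (random_mx_layer sL mz my).
  exact: measurable_hs_lipschitz F'L mz.
have mF' := measurable_hs_lipschitz F'L mZ.
have mF := measurable_hs_lipschitz F1 mZ'.
rewrite mulrDl [(_ + 2) * _]mulrDl.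
apply: (@prob_le_cover2 _ _ _ P _
  [set w | t / 2 <= `|F' (random_netZ X W sigma k w) - kap * a|]
  ([set w | ~ net_bounded K (random_netZ X W sigma k w)] `|`
   [set w | Q (random_netZ X W sigma k w, W k w)])).
- exact: measurable_dev.
- exact: measurable_dev.
- apply: measurableU; last exact: mQ.
  by apply: measurableC; exact: measurable_net_bounded.
- move=> w /= tw.
  have [?|tw2] := leP (t / 2) `|F' (random_netZ X W sigma k w) - kap * a|; first by left.
  right.
  have [zK|?] := pselect (net_bounded K (random_netZ X W sigma k w)); last by left.
  right; split => //=; rewrite -netZS.
  have := ler_distD (F' (random_netZ X W sigma k w))
    (F (random_netZ X W sigma k.+1 w)) (kap * a).
  by move: tw tw2; rewrite /random_netZ; lra.
- have tk : 0 < t / (2 * kap) by rewrite divr_gt0// mulr_gt0.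
  have := Ha _ _ r1 tk.
  rewrite (_ : [set w | _] = [set w | t / 2 <= `|F' (random_netZ X W sigma k w) - kap * a|]).
    move/le_trans; apply; rewrite lee_fin weaken//.
    have : cc <= c2 by rewrite ge_min lexx.
    move/(ler_wpM2r e0)/le_trans; apply.
    rewrite /c2 mulrAC ler_pdivrMr// -[leRHS]mulrA ler_pM2l// /e -[leRHS]mulrA ler_wpM2l//.
    set x := t / r ^+ k.+1; set y := _ / r ^+ k.
    have xy : x ^+ 2 <= (2 * kap) ^+ 2 * y ^+ 2.
      rewrite -exprMn lerXn2r ?nnegrE//.
      - by rewrite divr_ge0 ?(ltW t0)// ltW.
      - by rewrite mulr_ge0 ?divr_ge0 ?mulr_ge0 ?(ltW kap0) ?(ltW t0)// ltW.
      have -> : 2 * kap * y = t / r ^+ k by rewrite /y; field; rewrite !gt_eqF.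
      by rewrite ler_pM2l// lef_pV2 ?posrE// exprS ler_peMl// ltW.
    have y2 := sqr_ge0 y; have r2 := sqr_ge0 r; have k2 := sqr_ge0 (2 * kap).
    rewrite minr_pMl ?(ltW kap4)// le_min; apply/andP; split.
      rewrite ge_min; apply/orP; left; rewrite mulrDr mulr1 lerDl mulr_ge0//.
    rewrite ge_min; apply/orP; right; rewrite mulrDr mulr1 mulrC; lra.
  apply/seteqP; split => w /=.
    rewrite invfM mulrA -[t / 2 / kap]mulrC ler_pdivrMl//.
    by rewrite -[X in X * `|_|]gtr0_norm// -normrM mulrBr mulVKf ?gt_eqF.
  rewrite invfM mulrA -[t / 2 / kap]mulrC ler_pdivrMl//.
  by rewrite -[X in X * `|_|]gtr0_norm// -normrM mulrBr mulVKf ?gt_eqF.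
apply: (@prob_le_cover2 _ _ _ P _ [set w | ~ net_bounded K (random_netZ X W sigma k w)]
   [set w | Q (random_netZ X W sigma k w, W k w)]) => //.
- by apply: measurableU; [apply: measurableC; exact: measurable_net_bounded|exact: mQ].
- by apply: measurableC; exact: measurable_net_bounded.
- exact: mQ.
- apply: le_trans (Hnet _ _ _ P _ _ _ _ _ _ r M k_le r1) _; rewrite lee_fin weaken//.
  have : cc <= 1 by rewrite !ge_min lexx orbT.
  move/(ler_wpM2r e0)/le_trans; apply.
  by rewrite mul1r ler_wpM2l// ge_min lexx.
apply: (prob_next_layer_le M kL mQ) => z.
have [zK|zK] := pselect (net_bounded K z); last first.
  rewrite (_ : [set w | _] = set0) ?measure0 ?lee_fin ?mulr_ge0 ?expR_ge0//.
  by apply/seteqP; split => // w [].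
have mcst d' (T' : measurableType d') : random_mx (fun _ : T' => z).
  by move=> i j; exact: measurable_cst.
have mlay := random_mx_layer sL (mcst _ T) mW.
apply: (@prob_le_mono _ _ _ P _
   [set w | t / 2 <= `|F (layer (sigma k) z (W k w)) - F' z|]).
- exact: mQ.
- by apply: measurable_dev; exact: measurable_hs_lipschitz F1 mlay.
- by move=> w [].
pose kp := 1 * (lam * (2 * K) / Num.sqrt q%:R).
have kp0 : 0 < kp by rewrite /kp mul1r divr_gt0// mulr_gt0// mulr_gt0.
have K2 : 0 <= 2 * K by rewrite mulr_ge0// ltW.
have lipG := layer_comp_lipschitz (ltW lam0) sL K2 (net_bounded_op zK) ler01 F1.
have [_ tail] := Hmean _ _ P _ _ (W k) _ kp mW subW kp0 lipG.
have tk : 0 < t / 2 / kp by rewrite !divr_gt0.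
have := tail _ tk; rewrite [kp * _]mulrC divfK ?gt_eqF//.
move/le_trans; apply; rewrite lee_fin weaken//.
have : cc <= c3 by rewrite !ge_min lexx !orbT.
move/(ler_wpM2r e0)/le_trans; apply.
apply: (@le_trans _ _ (c3 * (m * (t / r ^+ k.+1) ^+ 2))).
  by rewrite ler_pM2l// /e ler_wpM2l// ge_min lexx orbT.
have nq := width_ratio alpha0 N0 q0 (model_width M (kL : (1 <= k.+1 <= L)%N)).
rewrite -/m in nq.
have -> : c3 * (m * (t / r ^+ k.+1) ^+ 2) =
    c1 * ((t / r ^+ k.+1) ^+ 2 / (16 * (lam * A k) ^+ 2) * (m / (2 * alpha))).
  by rewrite /c3; field; rewrite !gt_eqF ?A0.
have -> : (t / 2 / kp) ^+ 2 =
    (t / r ^+ k.+1) ^+ 2 / (16 * (lam * A k) ^+ 2) * (q%:R / aspect n (N 0%N)).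
  rewrite /kp /K -[in RHS](sqr_sqrtr (ltW qR)) -[in RHS](sqr_sqrtr (ltW D0)).
  by field; rewrite !gt_eqF ?A0.
rewrite ler_pM2l// ler_wpM2l// divr_ge0 ?sqr_ge0// mulr_ge0 ?sqr_ge0//.
Qed.

End NetworkConcentration.

(** For [t > 1] the choice [r^(L+1) = t] balances the two terms, as [t / r^L = r]; for [t <= 1]
    already [r = 1] gives the minimum [t^2]. *)
Lemma rate_le_radius (R : realType) (L : nat) (t : R) : 0 < t ->
  exists2 r : R, 1 <= r & rate L t <= Order.min (r ^+ 2) ((t / r ^+ L) ^+ 2).
Proof.
move=> t0; have [t1|t1] := leP t 1.
  exists 1 => //; rewrite !expr1n divr1 le_min /rate !ge_min lexx !andbT.
  by rewrite expr_le1 ?(ltW t0)// t1.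
pose r := t `^ (L.+1%:R^-1); have r0 : 0 < r by rewrite powR_gt0.
have rL : r ^+ L.+1 = t.
  by rewrite -powR_mulrn ?powR_ge0// -powRrM mulVf// powRr1 ?ltW.
have r2 : r ^+ 2 = t `^ (2 / L.+1%:R).
  by rewrite -powR_mulrn ?powR_ge0// -powRrM mulrC.
exists r; first by rewrite -[leLHS](powRr0 t); apply: ler_powR; rewrite ?invr_ge0 ?ltW.
have -> : t / r ^+ L = r by rewrite -[in LHS]rL exprS mulfK// gt_eqF ?exprn_gt0.
by rewrite minxx r2 /rate ge_min lexx orbT.
Qed.

Unset Implicit Arguments. Set Strict Implicit. Set Printing Implicit Defensive.

Theorem theorem3p14 (R : realType) (L : nat) (rho lam alpha : R) :
  0 < rho -> 0 < lam -> 0 < alpha ->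
  exists c : R, 0 < c /\
  forall (d : measure_display) (T : measurableType d) (P : probability T R)
    (n : nat) (N : nat -> nat)
    (X : T -> 'M[R]_(N 0%N, n))
    (W : forall l : nat, T -> 'M[R]_(N l.+1, N l))
    (sigma : nat -> R -> R),
    (0 < n)%N -> (forall l, (l <= L)%N -> (0 < N l)%N) ->
    random_mx X -> (forall l, (l < L)%N -> random_mx (W l)) ->
    (* (1) X, W_0, ..., W_{L-1} mutually independent *)
    (forall (SX : set 'M[R]_(N 0%N, n)) (S : forall l, set 'M[R]_(N l.+1, N l)),
        mx_borel SX -> (forall l, (l < L)%N -> mx_borel (S l)) ->
        P (X @^-1` SX `&` \bigcap_(l in [set l | (l < L)%N]) (W l @^-1` S l))
        = (P (X @^-1` SX) * \prod_(l < L) P (W l @^-1` S l))%E) ->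
    (* (2) subgaussian concentration *)
    subgaussian_conc P rho X ->
    (forall l, (l < L)%N -> subgaussian_conc P rho (W l)) ->
    (* (3) X centered *)
    (forall i j, ('E_P[fun w => X w i j] = 0)%E) ->
    (* (5) symmetric laws of W_l *)
    (forall l, (l < L)%N -> symmetric_law P (W l)) ->
    (* (6) sigma_l lam-Lipschitz and odd *)
    (forall l, (l < L)%N -> forall x y, `|sigma l x - sigma l y| <= lam * `|x - y|) ->
    (forall l, (l < L)%N -> forall x, sigma l (- x) = - sigma l x) ->
    (* (7) n / n_l <= alpha for l = 1..L *)
    (forall l, (1 <= l <= L)%N -> n%:R / (N l)%:R <= alpha) ->
    forall F : 'M[R]_(N L, n) -> R, hs_lipschitz 1 F ->
    forall t : R, 0 < t ->
    (P [set w | (t%:E <= `| (F (netZ (X w) (fun l => W l w) sigma L))%:E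
                 - 'E_P[fun w' => F (netZ (X w') (fun l => W l w') sigma L)] |)%E]
     <= (2 * expR (- c * (minn n (N 0%N))%:R
                     * Order.min (t ^+ 2) (t `^ (2 / (L.+1)%:R))))%:E)%E.
Proof.
move=> rho0 lam0 alpha0.
have [C [c [C0 c0 H]]] := netZ_conc L rho0 lam0 alpha0.
have [c' c'0 Hrec] := tail_recenter L C0 c0.
exists c'; split => // d T P n N X W sigma n0 N0 mX mW ind subX subW EX symW sL sodd width F F1.
have M : network_model L rho lam alpha P X W sigma by [].
have [a Ha] := H _ _ _ P _ _ _ _ _ _ M (leqnn L) F1.
have mF := measurable_hs_lipschitz F1 (random_mx_Z M (leqnn L)).
(* Positivity of the widths supplies the lower bound on [m] under which recentering is uniform. *)
have m1 : 1 <= (minn n (N 0%N))%:R :> R by rewrite ler1n leq_min n0 N0.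
have [|intF tail] := Hrec _ _ P _ _ a m1 mF.
  move=> t t0; have [r r1 rt] := rate_le_radius L t0.
  apply: le_trans (Ha r t r1 t0) _; rewrite lee_fin ler_wpM2l// ler_expR lerN2.
  by rewrite ler_pM2l// ler_wpM2l.
move=> t t0; have := tail t t0.
(* Integrability, obtained with the recentered tail, makes the extended-real expectation finite and
   equal to the real integral. *)
have -> : 'E_P[fun w' => F (netZ (X w') (fun l => W l w') sigma L)]%E =
    (\int[P]_w F (netZ (X w) (fun l => W l w) sigma L))%:E.
  by rewrite unlock /Rintegral fineK//; exact: integrable_fin_num.
by rewrite !mulNr -mulrA.
Qed.
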